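(* Let $X\ge1$, $q$ a positive integer, $\sigma_0>0$, and $s\in\mathbb C$ with $\zeta(s)\ne0$, $s\notin Z=\{1+2\pi i k/\log2:\ k\in\mathbb Z\setminus\{0\}\}$ and $\Re s=\sigma\ge\sigma_0$. Then \[ \Bigl|\sum_{\substack{n\le X\\(n,q)=1}}\frac{\mu(n)}{n^{s}}-\frac{m_q(X)}{X^{s-1}}-\frac{q^s}{\varphi_s(q)}\frac1{\zeta(s)}\Bigr|\le\frac{\sigma+|s|}{\sigma|c(s)\zeta(s)|X^{\sigma}}\int_1^X|m_q(t)|\,dt+\frac{|c(s)|+2^{\sigma_0}e(s)}{|c(s)\zeta(s)|X^{\sigma_0}}\frac{q^{\sigma-\sigma_0}}{\varphi_{\sigma-\sigma_0}(q)}, \] where $c(s)=\frac{1-2^{1-s}}{s-1}$ (with $c(1)=\log2$) and $e(s)=2^{1-\sigma}\bigl(1+2^{|s-1|-1}|s-1|\log2\bigr)\log2$. Furthermore, when $s=\sigma$ is real, the factor $(\sigma+|s|)/\sigma$ may be replaced by $1$.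
   Context: $\mu$ is the Möbius function, $\zeta$ the Riemann zeta function. $m_q(t)=\sum_{n\le t,\,(n,q)=1}\mu(n)/n$. For complex $w$, $\varphi_w(q)=q^w\prod_{p\mid q}(1-p^{-w})$, $p$ running over primes. *)

(* Defs.v *)
From HB Require Import structures.
From mathcomp Require Import all_boot all_order all_algebra.
From mathcomp Require Import all_classical all_reals all_analysis.
From mathcomp Require Import complex.

Set Implicit Arguments.
Unset Strict Implicit.
Unset Printing Implicit Defensive.

Import Order.TTheory GRing.Theory Num.Theory.
Import numFieldNormedType.Exports.

Local Open Scope classical_set_scope.
Local Open Scope ring_scope.
Local Open Scope complex_scope.

Definition mobius (n : nat) : int :=
  if (0 < n)%N && all (fun p => logn p n == 1%N) (primes n)
  then (-1) ^+ size (primes n) else 0.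

Section Defs.
Context {R : realType}.
Implicit Types (s w z : R[i]) (t x : R) (q : nat).

Definition cabs z : R := complex.Re `|z|.

Definition cexp z : R[i] :=
  (expR (complex.Re z))%:C * (cos (complex.Im z) +i* sin (complex.Im z)).

(* x ^ s with the principal (real) logarithm; meaningful for 0 < x only. *)
Definition cpow x s : R[i] := cexp (s * (ln x)%:C).

Definition mq q t : R :=
  \sum_(1 <= n < (Num.truncn t).+1 | coprime n q) (mobius n)%:~R / n%:R.

Definition varphi w q : R[i] :=
  cpow q%:R w * \prod_(p <- primes q) (1 - cpow p%:R (- w)).

(* Sum of a power series on a disc of positive radius; R[i]^o is R[i] seen as a
   normed module over itself, which carries the topology. *)
Definition analytic_at (f : R[i] -> R[i]) z : Prop :=
  exists (a : nat -> R[i]) (r : R), 0 < r /\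
    forall w, cabs (w - z) < r ->
      series (fun n => a n * (w - z) ^+ n : R[i]^o) @ \oo --> (f w : R[i]^o).

(* The Riemann zeta function as the analytic continuation to C \ {1} of its
   Dirichlet series. The identity theorem determines f away from the pole 1;
   the value f 1 is unconstrained and must never be used. *)
Definition is_riemann_zeta (f : R[i] -> R[i]) : Prop :=
  (forall s, 1 < complex.Re s ->
     series (fun n => cpow n.+1%:R (- s) : R[i]^o) @ \oo --> (f s : R[i]^o)) /\
  (forall s, s != 1 -> analytic_at f s).

(* 1 / zeta, which vanishes at the pole of zeta. *)
Definition inv_zeta (zeta : R[i] -> R[i]) s : R[i] :=
  if s == 1 then 0 else (zeta s)^-1.

Definition Zset : set R[i] :=
  [set s | exists2 k : int, k != 0 & s = 1 +i* (2 * pi * k%:~R / ln 2)].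

Definition cfun s : R[i] :=
  if s == 1 then (ln 2)%:C else (1 - cpow 2 (1 - s)) / (s - 1).

Definition efun s : R :=
  2 `^ (1 - complex.Re s)
    * (1 + 2 `^ (cabs (s - 1) - 1) * cabs (s - 1) * ln 2)
    * ln 2.

(* Right-hand side of the estimate, with K the coefficient (sigma + |s|) / sigma
   or its replacement. Division by |c(s) zeta(s)| is expressed through inv_zeta,
   so that s = 1 is covered. The last quotient is taken in \bar R, where
   1 / 0 = +oo: this happens for Re s = sigma0 and 1 < q, the bound then being
   void. *)
Definition error_bound (zeta : R[i] -> R[i]) (X sigma0 : R) q s (K : R) : \bar R :=
  let sigma := complex.Re s in
  let inv_czeta := cabs (inv_zeta zeta s) / cabs (cfun s) in
  ((K * inv_czeta / X `^ sigma
      * \int[lebesgue_measure]_(t in `[1, X]) `|mq q t|)%:E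
   + ((cabs (cfun s) + 2 `^ sigma0 * efun s) * inv_czeta / X `^ sigma0)%:E
      * ((q%:R `^ (sigma - sigma0))%:E
         / (complex.Re (varphi (sigma - sigma0)%:C q))%:E))%E.

End Defs.

(* Main.v *)
(** Partial summation turns the left-hand side into an expression in
    (s - 1) int_1^X m_q(t) t^-s dt. Multiply by eta(s) = (1 - 2^(1-s)) zeta(s),
    the sum of the alternating series of (-1)^(n+1) n^-s, and cut that series at
    X/t inside the integral. The discarded tails are at most
    |s|/sigma (X/t)^-sigma (group consecutive terms in pairs), which gives the
    integral term, even with |s|/sigma instead of (sigma + |s|)/sigma. In what
    remains the convolution of mu_q with 1 - 2 1_{2|n} is explicit: it leaves
    sum_k (1/k) int_k^min(2k,X) u^-s du over the k whose prime factors all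
    divide q, that is c(s) sum_k k^-s up to the last term of the bound.
    All integrals are replaced by finite sums and by a Lipschitz bound on an
    explicit kernel. That eta(s) is the sum of the alternating series for
    0 < Re s follows from the case Re s > 1 by a Vitali-type argument along a
    segment avoiding 1. *)

Require Import Defs.
From mathcomp Require Import all_boot all_order all_algebra.
From mathcomp Require Import all_classical all_reals all_analysis.
From mathcomp Require Import measurable_realfun complex.
From mathcomp Require Import ring lra zify.

Import Order.TTheory GRing.Theory Num.Theory.
Import numFieldNormedType.Exports.

Local Open Scope classical_set_scope.
Local Open Scope ring_scope.
Local Open Scope complex_scope.

Set Implicit Arguments.
Unset Strict Implicit.
Unset Printing Implicit Defensive.

(** * Complex modulus, exponential and powers *)

Section ComplexModulus.
Context {R : realType}.
Implicit Types (z w : R[i]) (x y t : R).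

(** The alternating series serves because it is usable for every s of positive real part, with an
    error of the size of the first omitted term, and because its convolution with mu_q stays
    explicit. The cut at X/t makes this error uniform: a tail of size (X/t)^-sigma against |t^-s| =
    t^-sigma leaves X^-sigma whatever t is. The kernel thus has a single Lipschitz constant on
    [1, X], and summation by parts against m_q costs the integral of |m_q|. Since eta(s) = (s - 1)
    c(s) zeta(s), a common factor s - 1 cancels and c(s) is left in the denominators; at s = 1 both
    sides are 0. The last term of the bound collects two losses over the k composed of primes of q:
    the tail k > X, with weight |c(s)|, and the range X/2 <= k <= X, where min(2k, X) = X, with
    weight 2^sigma0 e(s). Both are dominated by the sum of k^-(sigma - sigma0) over all such k, an
    Euler product; for sigma = sigma0 and q > 1 it diverges and the bound is +oo. *)

Lemma cabsE z : `|z| = (cabs z)%:C.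
Proof. by rewrite /cabs normc_def. Qed.

Lemma cabs_real x : cabs x%:C = `|x|.
Proof. by rewrite /cabs normc_def /= expr0n addr0 sqrtr_sqr. Qed.

Lemma cabs_ge0 z : 0 <= cabs z.
Proof. by rewrite /cabs normc_def /= sqrtr_ge0. Qed.

Lemma cabsM z w : cabs (z * w) = cabs z * cabs w.
Proof. by apply: complexI; rewrite rmorphM /= -!cabsE normrM. Qed.

Lemma cabsV z : cabs z^-1 = (cabs z)^-1.
Proof. by apply: complexI; rewrite fmorphV /= -!cabsE normfV. Qed.

Lemma cabsN z : cabs (- z) = cabs z.
Proof. by rewrite /cabs normrN. Qed.

Lemma cabsC z w : cabs (z - w) = cabs (w - z).
Proof. by rewrite /cabs distrC. Qed.

Lemma cabs0 : cabs (0 : R[i]) = 0.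
Proof. by rewrite /cabs normr0. Qed.

Lemma cabs1 : cabs (1 : R[i]) = 1.
Proof. by rewrite /cabs normr1. Qed.

Lemma cabs_eq0 z : (cabs z == 0) = (z == 0).
Proof. by rewrite -[RHS]normr_eq0 cabsE -(inj_eq (@complexI R)). Qed.

Lemma cabs_gt0 z : (0 < cabs z) = (z != 0).
Proof. by rewrite lt_neqAle cabs_ge0 andbT eq_sym cabs_eq0. Qed.

Lemma cabsX z n : cabs (z ^+ n) = cabs z ^+ n.
Proof. by elim: n => [|n ih]; rewrite ?expr0 ?cabs1 // !exprS cabsM ih. Qed.

Lemma ler_cabsD z w : cabs (z + w) <= cabs z + cabs w.
Proof. by rewrite -lecR rmorphD /= -!cabsE ler_normD. Qed.

Lemma ler_cabsB z w : cabs (z - w) <= cabs z + cabs w.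
Proof. by rewrite -[cabs w]cabsN ler_cabsD. Qed.

Lemma ler_cabs_distl z w v : cabs (z - w) <= cabs (z - v) + cabs (v - w).
Proof.
have -> : z - w = (z - v) + (v - w) by ring.
exact: ler_cabsD.
Qed.

Lemma ler_cabs_sum (I : Type) (r : seq I) (P : pred I) (F : I -> R[i]) :
  cabs (\sum_(i <- r | P i) F i) <= \sum_(i <- r | P i) cabs (F i).
Proof.
elim: r => [|i r ih]; first by rewrite !big_nil cabs0.
rewrite !big_cons; case: (P i) => //.
by apply: le_trans (ler_cabsD _ _) _; rewrite lerD2l.
Qed.

Lemma cabs_nat n : cabs (n%:R : R[i]) = n%:R.
Proof. by rewrite -[n%:R in LHS](rmorph_nat (real_complex R)) /= cabs_real normr_nat. Qed.

Lemma Re_le_cabs z : complex.Re z <= cabs z.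
Proof.
rewrite /cabs normc_def /=; apply: le_trans (ler_norm _) _.
by rewrite -sqrtr_sqr ler_sqrt ?lerDl ?sqr_ge0 // addr_ge0 // sqr_ge0.
Qed.

Lemma cabs_Re z : complex.Im z = 0 -> 0 <= complex.Re z ->
  cabs z = complex.Re z.
Proof.
by case: z => a b /= -> a0; rewrite complexr0 cabs_real ger0_norm.
Qed.

Lemma Re_mul_real x z : complex.Re (z * x%:C) = complex.Re z * x.
Proof. by case: z => a b /=; rewrite mulr0 subr0. Qed.

End ComplexModulus.

Section ComplexExponential.
Context {R : realType}.
Implicit Types (z w s : R[i]) (x y t : R).

Lemma cexpD z w : cexp (z + w) = cexp z * cexp w.
Proof.
case: z => a b; case: w => c d; rewrite /cexp /= expRD cosD sinD.
by apply/eqP; rewrite eq_complex /=; apply/andP; split; apply/eqP; ring.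
Qed.

Lemma cexp0 : cexp (0 : R[i]) = 1.
Proof. by rewrite /cexp /= expR0 cos0 sin0 mul1r. Qed.

Lemma cexp_real x : cexp x%:C = (expR x)%:C.
Proof.
rewrite /cexp /= cos0 sin0; apply/eqP.
by rewrite eq_complex /= !mulr0 mulr1 mul0r subr0 addr0 !eqxx.
Qed.

Lemma cabs_cexp z : cabs (cexp z) = expR (complex.Re z).
Proof.
rewrite /cexp cabsM cabs_real ger0_norm ?expR_ge0 // /cabs normc_def /=.
by rewrite cos2Dsin2 sqrtr1 mulr1.
Qed.

Lemma cexp_neq0 z : cexp z != 0.
Proof. by rewrite -cabs_gt0 cabs_cexp expR_gt0. Qed.

Lemma cexpN z : cexp (- z) = (cexp z)^-1.
Proof.
apply: (mulfI (cexp_neq0 z)); rewrite -cexpD subrr cexp0 mulfV //.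
exact: cexp_neq0.
Qed.

Lemma cpowD x z w : cpow x (z + w) = cpow x z * cpow x w.
Proof. by rewrite /cpow mulrDl cexpD. Qed.

Lemma cpowN x z : cpow x (- z) = (cpow x z)^-1.
Proof. by rewrite /cpow mulNr cexpN. Qed.

Lemma cpow_neq0 x z : cpow x z != 0.
Proof. exact: cexp_neq0. Qed.

Lemma cpow1n z : cpow 1 z = 1.
Proof. by rewrite /cpow ln1 mulr0 cexp0. Qed.

Lemma cpow0 x : cpow x 0 = 1.
Proof. by rewrite /cpow mul0r cexp0. Qed.

Lemma cpow1 x : 0 < x -> cpow x 1 = x%:C.
Proof. by move=> x0; rewrite /cpow mul1r cexp_real lnK. Qed.

Lemma cpowM x y z : 0 < x -> 0 < y -> cpow (x * y) z = cpow x z * cpow y z.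
Proof. by move=> x0 y0; rewrite /cpow lnM // rmorphD mulrDr cexpD. Qed.

Lemma cabs_cpow x z : 0 < x -> cabs (cpow x z) = x `^ complex.Re z.
Proof.
by move=> x0; rewrite /cpow cabs_cexp Re_mul_real /powR gt_eqF.
Qed.

Lemma cpow_real x y : 0 < x -> cpow x y%:C = (x `^ y)%:C.
Proof. by move=> x0; rewrite /cpow -rmorphM cexp_real /powR gt_eqF. Qed.

End ComplexExponential.

(** * Mean value inequality *)

Section MeanValue.
Context {R : realType}.
Implicit Types (z w s : R[i]) (a b x y t : R).

Definition is_cderive (f : R -> R[i]) (t : R) (l : R[i]) : Prop :=
  is_derive t 1 (fun u => complex.Re (f u)) (complex.Re l) /\
  is_derive t 1 (fun u => complex.Im (f u)) (complex.Im l).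

(** A rotation making z real: it turns an inequality between moduli into one between real
    functions. *)
Lemma cabs_dual z : exists2 u, cabs u <= 1 & complex.Re (u * z) = cabs z.
Proof.
have [->|z0] := eqVneq z 0; first by exists 0; rewrite ?cabs0 ?mulr0.
exists (z^*%C / (cabs z)%:C).
  rewrite cabsM cabsV cabs_real ger0_norm ?cabs_ge0 //.
  have -> : cabs z^*%C = cabs z by rewrite /cabs normcJ.
  by rewrite mulfV // cabs_eq0.
rewrite mulrAC [z^*%C * z]mulrC -sqr_normc cabsE -rmorphXn -fmorphV.
rewrite Re_mul_real /= expr2 -mulrA mulfV ?mulr1 //.
by rewrite cabs_eq0.
Qed.

(** With [u] dual to f b - f a, the real function B - Re (u f) is nondecreasing. Taking a primitive
    [B] as majorant, and not a constant slope, gives the value of an integral bound without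
    integrating. *)
Lemma cabs_MVT (f df : R -> R[i]) (B dB : R -> R) a b : a <= b ->
  (forall t, a <= t <= b -> is_cderive f t (df t)) ->
  (forall t, a <= t <= b -> is_derive t 1 B (dB t)) ->
  (forall t, a <= t <= b -> cabs (df t) <= dB t) ->
  cabs (f b - f a) <= B b - B a.
Proof.
move=> ab hf hB hle.
set z := f b - f a.
have [u u1 uz] := cabs_dual z.
pose phi t := B t - (complex.Re u * complex.Re (f t) - complex.Im u * complex.Im (f t)).
pose dphi t := dB t - (complex.Re u * complex.Re (df t) - complex.Im u * complex.Im (df t)).
have hphi t : a <= t <= b -> is_derive t 1 phi (dphi t).
  move=> tab; have [h1 h2] := hf t tab; have h3 := hB t tab.
  exact: (is_deriveB h3 (is_deriveB (is_deriveZ (complex.Re u) h1)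
    (is_deriveZ (complex.Im u) h2))).
have dphi_ge0 t : a <= t <= b -> 0 <= dphi t.
  move=> tab; rewrite /dphi subr_ge0; apply: le_trans (hle t tab).
  have -> : complex.Re u * complex.Re (df t) - complex.Im u * complex.Im (df t)
     = complex.Re (u * df t) by case: (u) => ? ?; case: (df t).
  apply: le_trans (Re_le_cabs _) _; rewrite cabsM.
  by rewrite -[leRHS]mul1r ler_wpM2r // cabs_ge0.
have [c cab hc] : exists2 c, c \in `[a, b] & phi b - phi a = dphi c * (b - a).
  apply: MVT_segment => // [x xab|].
    by apply: hphi; move: xab; rewrite in_itv /= => /andP[/ltW -> /ltW ->].
  apply: derivable_within_continuous => x; rewrite in_itv /= => xab.
  by have [] := hphi x xab.
have : 0 <= phi b - phi a.
  rewrite hc; apply: mulr_ge0; last by rewrite subr_ge0.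
  by apply: dphi_ge0; move: cab; rewrite in_itv.
suff -> : phi b - phi a = (B b - B a) - complex.Re (u * z) by rewrite uz subr_ge0.
rewrite /phi /z; case: (f b) => ? ?; case: (f a) => ? ?; case: (u) => ? ? /=; ring.
Qed.

Lemma is_cderive_eq (f : R -> R[i]) t l l' :
  is_cderive f t l -> l = l' -> is_cderive f t l'.
Proof. by move=> h <-. Qed.

Lemma is_cderive_cst z t : is_cderive (fun=> z) t 0.
Proof. by split; exact: is_derive_cst. Qed.

Lemma is_cderiveD f g t l m : is_cderive f t l -> is_cderive g t m ->
  is_cderive (fun u => f u + g u) t (l + m).
Proof.
move=> [f1 f2] [g1 g2]; split.
  have := is_deriveD f1 g1; rewrite raddfD.
  by congr is_derive; apply/funext => u /=; rewrite raddfD.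
have := is_deriveD f2 g2; rewrite raddfD.
by congr is_derive; apply/funext => u /=; rewrite raddfD.
Qed.

Lemma is_cderiveZ f t l z : is_cderive f t l ->
  is_cderive (fun u => z * f u) t (z * l).
Proof.
case: z => a b [f1 f2]; split.
  have -> : (fun u => complex.Re ((a +i* b) * f u)) =
    (fun u => a * complex.Re (f u) - b * complex.Im (f u)).
    by apply/funext => u; case: (f u).
  apply: (is_derive_eq (is_deriveB (is_deriveZ a f1) (is_deriveZ b f2))).
  by case: (l).
have -> : (fun u => complex.Im ((a +i* b) * f u)) =
    (fun u => a * complex.Im (f u) + b * complex.Re (f u)).
    by apply/funext => u; case: (f u).
apply: (is_derive_eq (is_deriveD (is_deriveZ a f2) (is_deriveZ b f1))).
by case: (l).
Qed.

Lemma is_cderive_sum (I : Type) (r : seq I) (f : I -> R -> R[i]) t (l : I -> R[i]) :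
  (forall i, is_cderive (f i) t (l i)) ->
  is_cderive (fun u => \sum_(i <- r) f i u) t (\sum_(i <- r) l i).
Proof.
move=> h; elim: r => [|i r ih].
  rewrite big_nil; under eq_fun do rewrite big_nil.
  exact: is_cderive_cst.
rewrite big_cons; under eq_fun do rewrite big_cons.
exact: is_cderiveD.
Qed.

Lemma is_cderive_real (f : R -> R) t l :
  is_derive t 1 f l -> is_cderive (fun u => (f u)%:C) t l%:C.
Proof. by move=> h; split => //=; exact: is_derive_cst. Qed.

Lemma is_cderive_cexp z t :
  is_cderive (fun u => cexp (z * u%:C)) t (z * cexp (z * t%:C)).
Proof.
case: z => a b.
have E u : cexp ((a +i* b) * u%:C) =
  (expR (a * u) * cos (b * u)) +i* (expR (a * u) * sin (b * u)).
  rewrite /cexp /=; apply/eqP; rewrite eq_complex /= !mulr0 !mul0r subr0 !add0r.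
  by rewrite addr0 subr0 !eqxx.
have dz (k : R) : is_derive t 1 (fun u : R => k * u) k.
  by apply: is_derive_eq (is_deriveZ k (is_derive_id t 1)) _; rewrite /GRing.scale /= mulr1.
have he : is_derive t 1 (fun u : R => expR (a * u)) (a * expR (a * t)).
  by apply: is_derive_eq (is_derive1_comp (is_derive_expR _) (dz a)) _; rewrite mulrC.
have hc : is_derive t 1 (fun u : R => cos (b * u)) (- b * sin (b * t)).
  by apply: is_derive_eq (is_derive1_comp (is_derive_cos _) (dz b)) _; rewrite mulNr mulrC mulNr mulrC.
have hs : is_derive t 1 (fun u : R => sin (b * u)) (b * cos (b * t)).
  by apply: is_derive_eq (is_derive1_comp (is_derive_sin _) (dz b)) _; rewrite mulrC.
split.
  under eq_fun do rewrite E /=.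
  apply: is_derive_eq (is_deriveM he hc) _.
  rewrite E /= /GRing.scale /=; ring.
under eq_fun do rewrite E /=.
apply: is_derive_eq (is_deriveM he hs) _.
rewrite E /= /GRing.scale /=; ring.
Qed.

End MeanValue.

(** * Taylor remainder of the exponential and differences of powers *)

Section ExponentialEstimates.
Context {R : realType}.
Implicit Types (z w s : R[i]) (a b x y t k : R).

Lemma is_derive_exprn n t : is_derive t 1 (fun u : R => u ^+ n) (n%:R * t ^+ n.-1).
Proof.
have -> : (fun u : R => u ^+ n) = (id : R -> R) ^+ n.
  by apply/funext => u; rewrite exprfctE.
apply: (is_derive_eq (is_deriveX n (is_derive_id t 1))).
by rewrite /GRing.scale /= mulr1.
Qed.

Lemma expR_ge_fact (n : nat) x : 0 <= x -> x ^+ n / n`!%:R <= expR x.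
Proof.
case: n => [|n] x0; first by rewrite expr0 fact0 divr1 -expR0 ler_expR.
by apply: le_trans (expR_ge1Dxn n x0); rewrite lerDr.
Qed.

(** Along the ray t w the remainder of order n + 1 vanishes at t = 0 and has derivative w times the
    remainder of order n, so the mean value inequality yields one more factor t at each induction
    step. *)
Lemma cexp_taylor w (N : nat) :
  cabs (cexp w - \sum_(j < N) (j`!%:R)^-1 * w ^+ j)
    <= cabs w ^+ N / N`!%:R * expR (cabs w).
Proof.
pose Rm n t := cexp (w * t%:C)
  - \sum_(j < n) ((j`!%:R)^-1 * w ^+ j) * (t ^+ j)%:C.
suff H n t : 0 <= t <= 1 ->
    cabs (Rm n t) <= (cabs w ^+ n / n`!%:R * expR (cabs w)) * t ^+ n.
  have := H N 1; rewrite /Rm mulr1 expr1n mulr1 ler01 lexx => /(_ isT).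
  by under eq_bigr do rewrite expr1n mulr1.
elim: n t => [|n ih] t /andP[t0 t1].
  rewrite /Rm big_ord0 subr0 cabs_cexp Re_mul_real !expr0 fact0 divr1 mul1r mulr1.
  rewrite ler_expR; apply: le_trans (_ : cabs w * t <= _).
    by rewrite ler_wpM2r // Re_le_cabs.
  by rewrite ler_piMr // cabs_ge0.
have Rm0 : Rm n.+1 0 = 0.
  rewrite /Rm mulr0 cexp0 big_ord_recl big1 ?addr0.
    by rewrite fact0 invr1 !expr0 !mul1r subrr.
  by move=> i _; rewrite /= expr0n /= mulr0.
have -> : Rm n.+1 t = Rm n.+1 t - Rm n.+1 0 by rewrite Rm0 subr0.
set C := cabs w ^+ n.+1 / n.+1`!%:R * expR (cabs w).
have -> : C * t ^+ n.+1 = C * t ^+ n.+1 - C * 0 ^+ n.+1 by rewrite expr0n mulr0 subr0.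
apply: (@cabs_MVT R (Rm n.+1) (fun t => w * Rm n t) (fun t => C * t ^+ n.+1)
  (fun t => C * (n.+1%:R * t ^+ n))) => // u /andP[u0 ut].
- have -> : Rm n.+1 = fun u : R => cexp (w * u%:C) +
    (-1) * \sum_(j < n.+1) ((j`!%:R)^-1 * w ^+ j) * (u ^+ j)%:C.
    by apply/funext => v; rewrite mulN1r.
  have hj (j : 'I_n.+1) := is_cderiveZ ((j`!%:R)^-1 * w ^+ j)
    (is_cderive_real (is_derive_exprn j u)).
  have h := is_cderiveD (is_cderive_cexp w u)
    (is_cderiveZ (-1) (is_cderive_sum (index_enum _) hj)).
  apply: (is_cderive_eq h).
  rewrite /Rm mulrBr mulN1r; congr (_ - _).
  rewrite big_ord_recl /= mul0r mulr0 add0r mulr_sumr; apply: eq_bigr => i _.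
  rewrite /bump /= add1n exprS rmorphM /= rmorph_nat factS natrM.
  have n1 : i.+1%:R != 0 :> R[i] by rewrite pnatr_eq0.
  have n2 : i`!%:R != 0 :> R[i] by rewrite pnatr_eq0 -lt0n fact_gt0.
  move: n1 n2; move: (i.+1%:R : R[i]) (i`!%:R : R[i]) ((u ^+ i)%:C) (w ^+ i) => c d e f n1 n2.
  by field; rewrite n1 n2.
- apply: is_derive_eq (is_deriveZ C (is_derive_exprn n.+1 u)) _.
  by [].
- rewrite cabsM; apply: le_trans (ler_wpM2l (cabs_ge0 _) (ih u _)) _.
    by rewrite u0 (le_trans ut).
  rewrite /C factS natrM invfM exprS le_eqVlt; apply/orP; left; apply/eqP.
  by field; rewrite !pnatr_eq0 -lt0n fact_gt0 /=.
Qed.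

Lemma cexp_MVT z x y (B dB : R -> R) : x <= y ->
  (forall t, x <= t <= y -> is_derive t 1 B (dB t)) ->
  (forall t, x <= t <= y -> cabs z * expR (complex.Re z * t) <= dB t) ->
  cabs (cexp (z * y%:C) - cexp (z * x%:C)) <= B y - B x.
Proof.
move=> xy hB h.
apply: (@cabs_MVT R (fun t => cexp (z * t%:C)) (fun t => z * cexp (z * t%:C)) B dB) => // t txy.
  exact: is_cderive_cexp.
by rewrite cabsM cabs_cexp Re_mul_real h.
Qed.

(** The right-hand side is the integral of |s| v^(-sigma-1) over [a, b], computed in the variable ln
    v. Keeping it as a difference lets sums over consecutive pairs telescope. *)
Lemma cpow_opp_dist_le s a b : 0 < complex.Re s -> 0 < a -> a <= b ->
  cabs (cpow a (- s) - cpow b (- s)) <=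
  cabs s / complex.Re s * (a `^ (- complex.Re s) - b `^ (- complex.Re s)).
Proof.
move=> s0 a0 ab; have b0 : 0 < b := lt_le_trans a0 ab.
set k := complex.Re s in s0 *.
rewrite cabsC /cpow /powR !gt_eqF //.
pose B t := - (cabs s / k) * expR (- k * t).
have -> : cabs s / k * (expR (- k * ln a) - expR (- k * ln b)) = B (ln b) - B (ln a).
  by rewrite /B; ring.
apply: (@cexp_MVT _ _ _ B (fun t => cabs s * expR (- k * t))) => [|t _|t _].
- by rewrite ler_ln.
- have dz : is_derive t 1 (fun u : R => - k * u) (- k).
    by apply: is_derive_eq (is_deriveZ (- k) (is_derive_id t 1)) _; rewrite /GRing.scale /= mulr1.
  apply: is_derive_eq (is_deriveZ (- (cabs s / k)) (is_derive1_comp (is_derive_expR _) dz)) _.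
  by rewrite /GRing.scale /=; field; rewrite gt_eqF.
- by rewrite cabsN; case: (s) @k {s0 B} => ? ? /=.
Qed.

(** The integral of |1 - s| v^-sigma over [a, b], with v^-sigma bounded by its value at a; in
    logarithmic scale the majorant is a multiple of [expR]. *)
Lemma cpow_dist_le s a b : 0 <= complex.Re s -> 0 < a -> a <= b ->
  cabs (cpow b (1 - s) - cpow a (1 - s)) <=
  cabs (1 - s) * a `^ (- complex.Re s) * (b - a).
Proof.
move=> s0 a0 ab; have b0 : 0 < b := lt_le_trans a0 ab.
set c := _ * _ `^ _; pose B t := c * expR t.
have -> : c * (b - a) = B (ln b) - B (ln a) by rewrite /B !lnK // mulrBr.
apply: (@cexp_MVT _ _ _ B B) => [|t /andP[ta _]].
  by rewrite ler_ln.
rewrite /B /c -mulrA ler_wpM2l ?cabs_ge0 // /powR gt_eqF // -expRD ler_expR.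
case: s s0 {c B} => u v /= u0; rewrite mulrBl mul1r addrC mulNr lerD2r lerN2.
by rewrite ler_wpM2l.
Qed.

(** Origin of e(s). Write x = 2k exp(-L) with 0 <= L <= ln 2 and take out (2k)^(1-s), whose modulus
    supplies 2^(1-sigma). With w = (s - 1) L, the bound |exp w - 1| <= |w| + |w|^2 exp(|w|) / 2 and
    |w| <= |s - 1| ln 2 give the other factors. *)
Lemma cpow_dist_double_le s x k : 0 < k -> k <= x -> x <= 2 * k ->
  cabs (cpow (2 * k) (1 - s) - cpow x (1 - s))
    <= k `^ (1 - complex.Re s) * cabs (s - 1) * efun s.
Proof.
move=> k0 kx x2k; have x0 : 0 < x := lt_le_trans k0 kx.
have k20 : 0 < 2 * k by lra.
set L := ln (2 * k / x).
have L0 : 0 <= L by rewrite ln_ge0 // ler_pdivlMr // mul1r.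
have L2 : L <= ln 2.
  by rewrite ler_ln ?posrE ?divr_gt0 // ler_pdivrMr // ler_pM2l.
set w := (s - 1) * L%:C.
have wE : cpow x (1 - s) = cpow (2 * k) (1 - s) * cexp w.
  rewrite /w /L ln_div ?posrE // /cpow -cexpD rmorphB /=.
  by congr cexp; ring.
rewrite wE -{1}[cpow _ _]mulr1 -mulrBr cabsM cabs_cpow //.
have -> : complex.Re (1 - s) = 1 - complex.Re s by case: (s).
rewrite powRM ?(ltW k0) //.
set p := k `^ _; set p2 := 2 `^ _.
have wle : cabs w <= cabs (s - 1) * ln 2.
  by rewrite /w cabsM cabs_real ger0_norm // ler_wpM2l ?cabs_ge0.
have ln20 : 0 < ln 2 :> R by rewrite ln_gt0 // ltr1n.
have h : cabs (1 - cexp w) <= cabs (s - 1) * ((1 + 2 `^ (cabs (s - 1) - 1) * cabs (s - 1) * ln 2) * ln 2).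
  have := cexp_taylor w 2; rewrite !big_ord_recl big_ord0 /= addr0.
  rewrite !factS fact0 invr1 !mul1r expr0 expr1 => hT.
  rewrite cabsC; have -> : cexp w - 1 = (cexp w - (1 + w)) + w by ring.
  apply: le_trans (ler_cabsD _ _) _.
  apply: le_trans (lerD hT wle) _.
  have := cabs_ge0 (s - 1); set a := cabs (s - 1) in wle * => a0.
  have -> : 2 `^ (a - 1) = expR (a * ln 2) / 2.
    by rewrite powRB ?pnatr_eq0 ?implybT // powRr1 // /powR gt_eqF.
  have h1 : cabs w ^+ 2 <= (a * ln 2) ^+ 2 by rewrite lerXn2r ?nnegrE ?cabs_ge0 ?mulr_ge0 ?(ltW ln20).
  have h2 : expR (cabs w) <= expR (a * ln 2) by rewrite ler_expR.
  have h3 : cabs w ^+ 2 * expR (cabs w) <= (a * ln 2) ^+ 2 * expR (a * ln 2).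
    by rewrite ler_pM // ?exprn_ge0 ?cabs_ge0 ?expR_ge0.
  rewrite mulrAC; set E := expR _ in h3 *; set E' := expR _ in h3 *.
  nra.
have p0 : 0 <= p2 * p by rewrite mulr_ge0 ?powR_ge0.
apply: le_trans (ler_wpM2l p0 h) _.
by rewrite le_eqVlt; apply/orP; left; apply/eqP; rewrite /efun -/p2 -/p; ring.
Qed.

End ExponentialEstimates.

(** * Moebius sums *)

Section Arithmetic.
Implicit Types (d k m n p q N : nat).

Lemma mobius_eq0 p d : prime p -> (0 < d)%N -> (p ^ 2 %| d)%N -> mobius d = 0.
Proof.
move=> pp d0 pd; rewrite /mobius d0 /= (_ : all _ _ = false) //.
have l2 : (2 <= logn p d)%N by rewrite -pfactor_dvdn.
apply/negP => /allP /(_ p).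
rewrite mem_primes pp d0 (dvdn_trans _ pd) ?dvdn_exp // => /(_ isT) /eqP h.
by rewrite h in l2.
Qed.

Lemma mobius_prime_mul p d : prime p -> (0 < d)%N -> ~~ (p %| d)%N ->
  mobius (p * d) = - mobius d.
Proof.
move=> pp d0 pd; have p0 := prime_gt0 pp.
have pm : perm_eq (primes (p * d)) (p :: primes d).
  apply: uniq_perm; rewrite ?primes_uniq //=.
    by rewrite primes_uniq andbT mem_primes d0 (negbTE pd) !andbF.
  by move=> r; rewrite primesM // primes_prime // !inE.
rewrite /mobius muln_gt0 p0 d0 /= (perm_all _ pm) (perm_size pm) /=.
rewrite lognM // logn_prime // eqxx (_ : logn p d = 0%N) /=; last first.
  by apply/eqP; rewrite -leqn0 -ltnS ltnNge -[1%N]/(0.+1)%N -pfactor_dvdn ?expn1.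
rewrite (eq_in_all (a2 := fun r => logn r d == 1%N)); last first.
  move=> r; rewrite mem_primes => /and3P[pr _ rd].
  have rp : r != p by apply: contraNneq pd => <-.
  by rewrite lognM // logn_prime // (negbTE rp).
by case: ifP => _; rewrite ?oppr0 // exprS mulN1r.
Qed.

(** A list of primes instead of q, so that the Euler product can be built one prime at a time. *)
Definition smooth (P : seq nat) k := all (mem P) (primes k).

(** If all primes of k divide q, only d = 1 is coprime to q; a prime of k not dividing q makes the
    sum cancel. *)
Lemma sum_mobius_coprime q k : (0 < q)%N -> (0 < k)%N ->
  \sum_(d <- divisors k | coprime d q) mobius d = (smooth (primes q) k)%:R.
Proof.
move=> q0 k0; have [sm|/allPn[p pk pq]] := boolP (smooth _ _).
  rewrite -big_filter (bigD1_seq 1%N) ?filter_uniq ?divisors_uniq //=; last first.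
    by rewrite mem_filter coprime1n -dvdn_divisors ?dvd1n.
  rewrite big1_seq ?addr0 //= => d /andP[d1]; rewrite mem_filter => /andP[cdq].
  rewrite -dvdn_divisors // => dk; exfalso.
  have d0 : (0 < d)%N := dvdn_gt0 k0 dk.
  have pd : prime (pdiv d) by apply: pdiv_prime; rewrite ltn_neqAle eq_sym d1.
  have pk : pdiv d \in primes k.
    by rewrite mem_primes pd k0 (dvdn_trans (pdiv_dvd d)).
  have := allP sm _ pk; rewrite inE mem_primes pd q0 /= => pdq.
  have : (pdiv d %| gcdn d q)%N by rewrite dvdn_gcd pdiv_dvd.
  by rewrite (eqP cdq) dvdn1 => /eqP h; rewrite h in pd.
move: pk; rewrite mem_primes => /and3P[pp _ pk].
move: pq; rewrite inE mem_primes pp q0 /= => pq.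
have cpq : coprime p q by rewrite prime_coprime.
have p0 := prime_gt0 pp.
(* The sum over d with p^2 not dividing d changes sign under the involution
   exchanging d and p d. *)
pose D := [seq d <- divisors k | coprime d q & ~~ (p ^ 2 %| d)%N].
pose f d := if (p %| d)%N then (d %/ p)%N else (p * d)%N.
have memD d : d \in D = [&& (d %| k)%N, coprime d q & ~~ (p ^ 2 %| d)%N].
  by rewrite mem_filter -dvdn_divisors // andbC.
have Df : {in D, forall d, f d \in D /\ mobius (f d) = - mobius d}.
  move=> d dD; have /and3P[dk cdq p2d] := etrans (esym (memD d)) dD.
  have d0 := dvdn_gt0 k0 dk.
  rewrite /f; case: ifP => pd.
    have dE : d = (p * (d %/ p))%N by rewrite mulnC divnK.
    have e0 : (0 < d %/ p)%N by rewrite divn_gt0 // dvdn_leq.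
    have pe : ~~ (p %| d %/ p)%N.
      by apply: contra p2d => pe; rewrite dE expnS expn1 dvdn_mul.
    split; last by rewrite {2}dE mobius_prime_mul // opprK.
    rewrite memD (dvdn_trans _ dk) ?dvdn_div //=.
    move: cdq; rewrite {1}dE coprimeMl => /andP[_ ->] /=.
    by apply: contra p2d => /dvdn_trans; apply; exact: dvdn_div.
  split; last by rewrite mobius_prime_mul ?pd.
  rewrite memD coprimeMl cpq cdq Gauss_dvd ?pk ?dk; last by rewrite prime_coprime ?pd.
  by rewrite expnS expn1 dvdn_pmul2l ?pd.
have ff : {in D, cancel f f}.
  move=> d; rewrite memD => /and3P[dk cdq p2d]; rewrite /f.
  case: (boolP (p %| d)%N) => pd; last by rewrite dvdn_mulr // mulKn.
  have dE : d = (p * (d %/ p))%N by rewrite mulnC divnK.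
  rewrite ifF -?dE //; apply/negbTE; apply: contra p2d => pe.
  by rewrite dE expnS expn1 dvdn_mul.
have uD : uniq D by rewrite filter_uniq // divisors_uniq.
have pD : perm_eq (map f D) D.
  apply: uniq_perm => //; first by rewrite map_inj_in_uniq //; exact: can_in_inj ff.
  move=> d; apply/mapP/idP => [[e eD ->]|dD]; first by case: (Df _ eD).
  by exists (f d); [case: (Df _ dD)|rewrite ff].
have -> : \sum_(d <- divisors k | coprime d q) mobius d = \sum_(d <- D) mobius d.
  rewrite big_filter_cond (bigID (fun d => ~~ (p ^ 2 %| d)%N)) /=.
  rewrite [X in _ + X]big1_seq ?addr0 //.
    by apply: eq_bigl => d; rewrite andbT.
  move=> d /andP[/andP[_ /negPn p2d]]; rewrite -dvdn_divisors // => dk.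
  by apply: mobius_eq0 p2d => //; exact: dvdn_gt0 dk.
have : \sum_(d <- D) mobius d = - \sum_(d <- D) mobius d.
  rewrite -{1}(perm_big _ pD) big_map -sumrN.
  by apply: eq_big_seq => d /Df[].
lia.
Qed.

(** * Convolution of mu_q with finitely supported functions *)

Section MobiusSums.
Context {K : comNzRingType}.
Implicit Types F G : nat -> K.

Lemma sum_multiples d N F : (0 < d)%N ->
  \sum_(1 <= k < N.+1 | (d %| k)%N) F k = \sum_(1 <= m < (N %/ d).+1) F (d * m)%N.
Proof.
move=> d0; elim: N => [|N ih]; first by rewrite div0n !big_geq.
rewrite big_mkcond big_nat_recr //= -big_mkcond ih divnS //=.
case: ifP => dN; last by rewrite addr0 add0n.
rewrite add1n [RHS]big_nat_recr //=; congr (_ + F _).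
have := divnS N d0; rewrite dN add1n => <-.
by rewrite mulnC divnK.
Qed.

Lemma sum_trim (a b : nat) F : (a <= b)%N -> (forall k, (a < k)%N -> F k = 0) ->
  \sum_(1 <= k < b.+1) F k = \sum_(1 <= k < a.+1) F k.
Proof.
move=> ab F0; rewrite (@big_cat_nat _ _ _ a.+1) //=.
rewrite [X in _ + X]big_nat_cond [X in _ + X]big1 ?addr0 // => k /andP[/andP[ak _] _].
exact: F0.
Qed.

(** As F vanishes beyond N, the inner sum may run to N for every d; grouping by k = d m leaves the
    divisor sum of [sum_mobius_coprime]. *)
Lemma sum_mobius_mul q N F : (0 < q)%N -> (forall k, (N < k)%N -> F k = 0) ->
  \sum_(1 <= d < N.+1 | coprime d q) (mobius d)%:~R *
    \sum_(1 <= m < N.+1) F (d * m)%N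
  = \sum_(1 <= k < N.+1 | smooth (primes q) k) F k.
Proof.
move=> q0 F0.
transitivity (\sum_(1 <= d < N.+1 | coprime d q) \sum_(1 <= k < N.+1 | (d %| k)%N)
    (mobius d)%:~R * F k).
  rewrite big_nat_cond [RHS]big_nat_cond.
  apply: eq_bigr => d /andP[/andP[d0 _] _].
  rewrite -mulr_sumr sum_multiples //; congr (_ * _).
  apply: sum_trim; first exact: leq_div.
  by move=> k; rewrite ltn_divLR // mulnC => /F0.
rewrite (exchange_big_dep xpredT) //= [RHS]big_mkcond /=.
rewrite big_nat_cond [RHS]big_nat_cond; apply: eq_bigr => k /andP[/andP[k0 kN] _].
rewrite -mulr_suml.
have := sum_mobius_coprime q0 k0.
move/(congr1 (fun z : int => z%:~R : K)).
rewrite (rmorph_sum (intmul 1)) /= natz => h.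
transitivity ((\sum_(d <- divisors k | coprime d q) (mobius d)%:~R) * F k).
  congr (_ * _); rewrite -[LHS]big_filter -[RHS]big_filter; apply: perm_big.
  apply: uniq_perm; rewrite ?filter_uniq ?iota_uniq ?divisors_uniq //.
  move=> d; rewrite !mem_filter mem_index_iota -dvdn_divisors //.
  case: (coprime d q) => //=; case dk : (d %| k)%N => //=.
  by rewrite (dvdn_gt0 k0 dk) (leq_ltn_trans (dvdn_leq k0 dk)).
by rewrite h; case: (smooth _ _); rewrite ?mul1r ?mul0r.
Qed.

(** The sign (-1)^(m-1) is 1 minus twice the indicator of even m, so this is [sum_mobius_mul]
    applied to F(k) - 2 F(2k). *)
Lemma sum_mobius_mul_alt q N F : (0 < q)%N -> (forall k, (N < k)%N -> F k = 0) ->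
  \sum_(1 <= d < N.+1 | coprime d q) (mobius d)%:~R *
    \sum_(1 <= m < N.+1) (-1) ^+ m.-1 * F (d * m)%N
  = \sum_(1 <= k < N.+1 | smooth (primes q) k) (F k - 2 * F (2 * k)%N).
Proof.
move=> q0 F0; rewrite -(@sum_mobius_mul q N (fun k => F k - 2 * F (2 * k)%N)) //; last first.
  by move=> k Nk; rewrite !F0 ?mulr0 ?subr0 //; lia.
rewrite big_nat_cond [RHS]big_nat_cond; apply: eq_bigr => d /andP[/andP[d0 _] _].
congr (_ * _); rewrite sumrB.
have -> : \sum_(1 <= m < N.+1) 2 * F (2 * (d * m))%N =
  \sum_(1 <= m < N.+1 | (2 %| m)%N) 2 * F (d * m)%N.
  rewrite sum_multiples //; under eq_bigr do rewrite mulnCA.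
  apply: sum_trim; first exact: leq_div.
  by move=> k; rewrite ltn_divLR // => Nk; rewrite F0 ?mulr0 //; nia.
rewrite [X in _ - X]big_mkcond -sumrB big_nat_cond [RHS]big_nat_cond.
apply: eq_bigr => m /andP[/andP[m0 _] _].
rewrite -signr_odd dvdn2 -[m in RHS](prednK m0) /=.
by case: (odd _) => /=; rewrite ?expr1 ?expr0 ?prednK //=; ring.
Qed.

End MobiusSums.
End Arithmetic.

(** * Euler product over the primes dividing q *)

Section EulerProduct.
Context {R : realType}.
Implicit Types (s : R[i]) (w e : R) (P : seq nat) (p k K : nat).

Definition smooth_sum P s K : R[i] :=
  \sum_(1 <= k < K.+1 | smooth P k) cpow k%:R (- s).

(** For P = [primes q] this is varphi_s(q) / q^s. *)
Definition euler_prod P s : R[i] := \prod_(p <- P) (1 - cpow p%:R (- s)).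

(** Among the k smooth over p :: P, those prime to p are the k smooth over P, and the others are p
    k' with k' again smooth over p :: P. *)
Lemma sum_smooth_cons (V : comNzRingType) (F : nat -> V) p P K : prime p -> p \notin P ->
  \sum_(1 <= k < K.+1 | smooth P k) F k =
  \sum_(1 <= k < K.+1 | smooth (p :: P) k) F k -
  \sum_(1 <= k < (K %/ p).+1 | smooth (p :: P) k) F (p * k)%N.
Proof.
move=> pp pP; have p0 := prime_gt0 pp.
have -> : \sum_(1 <= k < (K %/ p).+1 | smooth (p :: P) k) F (p * k)%N =
  \sum_(1 <= k < K.+1 | (p %| k)%N) (if smooth (p :: P) k then F k else 0).
  rewrite sum_multiples // big_mkcond /=.
  rewrite big_nat_cond [RHS]big_nat_cond; apply: eq_bigr => k /andP[/andP[k0 _] _].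
  rewrite (_ : smooth _ (p * k) = smooth (p :: P) k) //.
  rewrite /smooth; apply/allP/allP => h r.
    by move=> rk; apply: h; rewrite primesM // rk orbT.
  rewrite primesM // primes_prime // inE => /orP[/eqP ->|]; last exact: h.
  by rewrite !inE eqxx.
rewrite [X in _ = X - _]big_mkcond [X in _ - X]big_mkcond [LHS]big_mkcond -sumrB.
rewrite big_nat_cond [RHS]big_nat_cond; apply: eq_bigr => k /andP[/andP[k0 _] _].
have [pk|pk] := boolP (p %| k)%N; last first.
  rewrite subr0 (_ : smooth P k = smooth (p :: P) k) //.
  apply: eq_in_all => r; rewrite !inE mem_primes => /and3P[_ _ rk].
  by have /negbTE -> : r != p by apply: contraNneq pk => <-.
rewrite subrr (_ : smooth P k = false) //; apply/negbTE/allPn.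
by exists p; rewrite // mem_primes pp k0.
Qed.

Lemma prime_powR_lt1 p w : prime p -> 0 < w -> p%:R `^ (- w) < 1 :> R.
Proof.
move=> pp w0; have p1 : 1 < p%:R :> R by rewrite ltr1n prime_gt1.
rewrite /powR gt_eqF; last by apply: lt_trans p1.
by rewrite expR_lt1 mulNr oppr_lt0 mulr_gt0 // ln_gt0.
Qed.

Lemma prime_gt0r p : prime p -> 0 < p%:R :> R.
Proof. by move=> /prime_gt0; rewrite ltr0n. Qed.

Lemma euler_factor_ge p s w : prime p -> 0 < w -> w <= complex.Re s ->
  0 < 1 - p%:R `^ (- w) <= cabs (1 - cpow p%:R (- s)).
Proof.
move=> pp w0 ws; rewrite subr_gt0 prime_powR_lt1 //=.
have h : cabs (cpow p%:R (- s)) <= p%:R `^ (- w).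
  rewrite cabs_cpow ?prime_gt0r // raddfN /= ler_powR ?lerN2 //.
  by rewrite ler1n prime_gt0.
have := ler_cabsD (1 - cpow p%:R (- s)) (cpow p%:R (- s)).
rewrite subrK cabs1; lra.
Qed.

Lemma euler_prodE_real P w : all prime P ->
  euler_prod P w%:C = (\prod_(p <- P) (1 - p%:R `^ (- w)))%:C.
Proof.
move=> hP; rewrite rmorph_prod; apply: eq_big_seq => p /(allP hP) pp.
by rewrite rmorphB /= -rmorphN cpow_real ?prime_gt0r.
Qed.

Lemma euler_prod_inv_le P s w : all prime P -> 0 < w -> w <= complex.Re s ->
  cabs (euler_prod P s)^-1 <= (\prod_(p <- P) (1 - p%:R `^ (- w)))^-1.
Proof.
move=> hP w0 ws; rewrite cabsV /euler_prod.
elim: P hP => [|p P ih] /=; first by rewrite !big_nil cabs1.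
move=> /andP[pp hP]; rewrite !big_cons cabsM !invfM.
have /andP[h1 h2] := euler_factor_ge pp w0 ws.
apply: ler_pM; rewrite ?invr_ge0 ?cabs_ge0 ?ih //.
by rewrite lef_pV2 // posrE (lt_le_trans h1).
Qed.

(** Kept apart from the induction because it holds for every w: this covers q = 1 with sigma =
    sigma0. Both tails are 0 for K >= 1 and 1 for K = 0. *)
Lemma smooth_tail_nil_le s w e K :
  cabs ((euler_prod [::] s)^-1 - smooth_sum [::] s K) <=
  K.+1%:R `^ (- e) * ((\prod_(p <- [::] : seq nat) (1 - p%:R `^ (- w)))^-1
     - \sum_(1 <= k < K.+1 | smooth [::] k) k%:R `^ (- w)).
Proof.
rewrite /smooth_sum /euler_prod !big_nil !invr1.
have [->|K0] := posnP K.
  by rewrite !big_geq // !subr0 cabs1 powR1 mulr1.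
have sm (F : nat -> R[i]) : \sum_(1 <= k < K.+1 | smooth [::] k) F k = F 1%N.
  rewrite big_ltn_cond // /smooth /= big_nat_cond big1 ?addr0 //.
  move=> k /andP[/andP[k2 _]] /allP /(_ (pdiv k)).
  by rewrite mem_primes pdiv_prime // pdiv_dvd (ltnW k2) => /(_ isT).
have sm' (F : nat -> R) : \sum_(1 <= k < K.+1 | smooth [::] k) F k = F 1%N.
  by apply: complexI; rewrite rmorph_sum /= sm.
by rewrite sm sm' cpow1n powR1 !subrr cabs0 mulr0.
Qed.

(* Peeling off one prime p gives, for the tail E of either series,
   E_(p::P) K = E_P K + p^-s E_(p::P) (K/p), a recursion compatible with the
   claimed bound. *)
Lemma smooth_tail_le P s w e K : all prime P -> uniq P -> 0 < w \/ P = [::] -> 0 <= e ->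
  complex.Re s = w + e ->
  cabs ((euler_prod P s)^-1 - smooth_sum P s K) <=
  K.+1%:R `^ (- e) * ((\prod_(p <- P) (1 - p%:R `^ (- w)))^-1
     - \sum_(1 <= k < K.+1 | smooth P k) k%:R `^ (- w)).
Proof.
move=> hP uP [w0|->]; last by move=> _ _; exact: smooth_tail_nil_le.
move=> e0 sE; have ws : w <= complex.Re s by rewrite sE lerDl.
elim: P hP uP K => [|p P ihP] /=; first by move=> _ _ K; exact: smooth_tail_nil_le.
move=> /andP[pp hP] /andP[pP uP] K.
have p0 := prime_gt0 pp.
(* Strong induction on K inside the induction on P: the recursion calls the same list at K/p. *)
elim/ltn_ind: K => K ihK.
have [->|K0] := posnP K.
  rewrite /smooth_sum !big_geq // !subr0 powR1 mul1r.
  by apply: euler_prod_inv_le => //=; rewrite pp.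
have {ihK} ihK := ihK _ (ltn_Pdiv (prime_gt1 pp) K0).
have {ihP} ihP := ihP hP uP K.
have Ks : smooth_sum (p :: P) s K =
    smooth_sum P s K + cpow p%:R (- s) * smooth_sum (p :: P) s (K %/ p).
  rewrite /smooth_sum (sum_smooth_cons _ _ pp pP).
  rewrite mulr_sumr -addrA [- _ + _]addrC; set A := \sum_(_ <= _ < _ | _) _.
  rewrite -[LHS]addr0; congr (_ + _); apply/esym/eqP; rewrite subr_eq0; apply/eqP.
  rewrite big_nat_cond [RHS]big_nat_cond; apply: eq_bigr => k /andP[/andP[k0 _] _].
  by rewrite natrM cpowM // ltr0n.
have Kw : \sum_(1 <= k < K.+1 | smooth (p :: P) k) k%:R `^ (- w) =
    \sum_(1 <= k < K.+1 | smooth P k) k%:R `^ (- w) +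
    p%:R `^ (- w) * \sum_(1 <= k < (K %/ p).+1 | smooth (p :: P) k) k%:R `^ (- w) :> R.
  rewrite (sum_smooth_cons _ _ pp pP).
  rewrite mulr_sumr -addrA [- _ + _]addrC; set A := \sum_(_ <= _ < _ | _) _.
  rewrite -[LHS]addr0; congr (_ + _); apply/esym/eqP; rewrite subr_eq0; apply/eqP.
  by apply: eq_bigr => k _; rewrite natrM powRM.
rewrite Ks Kw {Ks Kw}.
have /andP[h1 h2] := euler_factor_ge pp w0 ws.
have Es : (euler_prod P s)^-1 =
    (1 - cpow p%:R (- s)) * (euler_prod (p :: P) s)^-1.
  rewrite /euler_prod big_cons invfM mulVKf // -cabs_gt0.
  exact: lt_le_trans h2.
have Ew : (\prod_(r <- P) (1 - r%:R `^ (- w)))^-1 =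
    (1 - p%:R `^ (- w)) * (\prod_(r <- p :: P) (1 - r%:R `^ (- w)))^-1 :> R.
  by rewrite big_cons invfM mulVKf // gt_eqF.
move: ihP ihK; rewrite Es Ew {Es Ew}.
set Is := (euler_prod _ _)^-1; set Iw := (\prod_(_ <- _) _)^-1.
set S1 := smooth_sum P s K; set S2 := smooth_sum _ _ _.
set W1 := \sum_(1 <= k < K.+1 | _) _; set W2 := \sum_(1 <= k < _ | _) _.
move=> ih1 ih2.
have -> : Is - (S1 + cpow p%:R (- s) * S2) =
  ((1 - cpow p%:R (- s)) * Is - S1) + cpow p%:R (- s) * (Is - S2) by ring.
have -> : Iw - (W1 + p%:R `^ (- w) * W2) =
  ((1 - p%:R `^ (- w)) * Iw - W1) + p%:R `^ (- w) * (Iw - W2) by ring.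
apply: le_trans (ler_cabsD _ _) _; rewrite [leRHS]mulrDr; apply: (lerD ih1).
have W2_ge0 : 0 <= Iw - W2.
  by have := le_trans (cabs_ge0 _) ih2; rewrite pmulr_rge0 // powR_gt0 ltr0n.
rewrite cabsM cabs_cpow ?prime_gt0r // raddfN /= sE opprD.
rewrite powRD ?pnatr_eq0 -?lt0n ?p0 ?implybT //.
apply: le_trans (ler_wpM2l _ ih2) _; first by rewrite mulr_ge0 ?powR_ge0.
(* The weight is taken at K + 1 because p (floor(K/p) + 1) >= K + 1, whereas p floor(K/p) may fall
   below K. *)
have key : p%:R `^ (- e) * (K %/ p).+1%:R `^ (- e) <= K.+1%:R `^ (- e) :> R.
  rewrite -powRM // !powRN lef_pV2 ?posrE ?powR_gt0 ?mulr_gt0 ?ltr0n //.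
  rewrite -natrM ge0_ler_powR ?nnegrE // ler_nat.
  by rewrite mulnC; apply: ltn_ceil.
rewrite mulrCA mulrA -mulrA [leLHS](_ : _ = p%:R `^ (- w) * (Iw - W2) *
  (p%:R `^ (- e) * (K %/ p).+1%:R `^ (- e))); last by ring.
by rewrite [leRHS]mulrC ler_wpM2l // mulr_ge0 ?powR_ge0.
Qed.

End EulerProduct.

(** * Taylor germs and analytic continuation *)

Section TaylorGerms.
Context {R : realType}.
Implicit Types (f g : R[i] -> R[i]) (z w h : R[i]) (a b : nat -> R[i]) (M A r e : R).

(* Analyticity at z in quantitative form. *)
Definition taylor_at f z a M A r : Prop :=
  (forall n, cabs (a n) <= M * A ^+ n) /\
  (forall N h, cabs h < r ->
     cabs (f (z + h) - \sum_(j < N) a j * h ^+ j) <= M * (A * cabs h) ^+ N).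

Lemma taylor_at_weaken f z a M A r M' A' r' : 0 <= A -> M <= M' -> A <= A' -> r' <= r ->
  0 <= M -> taylor_at f z a M A r -> taylor_at f z a M' A' r'.
Proof.
move=> A0 MM AA rr M0 [h1 h2]; split => [n|N h hr].
  apply: le_trans (h1 n) _; apply: ler_pM => //; first exact: exprn_ge0.
  by rewrite lerXn2r ?nnegrE // (le_trans A0).
apply: le_trans (h2 N h _) _; first exact: lt_le_trans rr.
have ch := cabs_ge0 h.
apply: ler_pM => //; first by rewrite exprn_ge0 // mulr_ge0.
by rewrite lerXn2r ?nnegrE ?mulr_ge0 // ?(le_trans A0) // ler_wpM2r.
Qed.

Lemma taylor_at_eq f g z a M A r : (forall s, f s = g s) ->
  taylor_at f z a M A r -> taylor_at g z a M A r.
Proof. by move=> fg [h1 h2]; split => // N h hr; rewrite -fg h2. Qed.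

Lemma taylor_atD f g z a b M M' A r :
  taylor_at f z a M A r -> taylor_at g z b M' A r ->
  taylor_at (fun s => f s + g s) z (fun n => a n + b n) (M + M') A r.
Proof.
move=> [f1 f2] [g1 g2]; split => [n|N h hr].
  by rewrite mulrDl (le_trans (ler_cabsD _ _)) // lerD.
under eq_bigr do rewrite mulrDl.
rewrite big_split /= opprD addrACA mulrDl (le_trans (ler_cabsD _ _)) //.
by rewrite lerD // ?f2 ?g2.
Qed.

Lemma taylor_atN f z a M A r : taylor_at f z a M A r ->
  taylor_at (fun s => - f s) z (fun n => - a n) M A r.
Proof.
move=> [f1 f2]; split => [n|N h hr]; first by rewrite cabsN.
under eq_bigr do rewrite mulNr.
by rewrite sumrN -opprD cabsN f2.
Qed.

(** With A and r common to all terms only M accumulates, so summable M give bounds uniform in K. *)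
Lemma taylor_at_sum (F : nat -> R[i] -> R[i]) (a : nat -> nat -> R[i])
    (M : nat -> R) z A r K :
  (forall k, taylor_at (F k) z (a k) (M k) A r) ->
  taylor_at (fun s => \sum_(k < K) F k s) z (fun n => \sum_(k < K) a k n)
    (\sum_(k < K) M k) A r.
Proof.
move=> hF; elim: K => [|K ih].
  split => [n|N h hr]; rewrite !big_ord0 ?cabs0 ?mul0r //.
  by rewrite big1 ?subrr ?cabs0 // => i _; rewrite big_ord0 mul0r.
rewrite big_ord_recr; have [h1 h2] := taylor_atD ih (hF K).
split => [n|N h hr]; first by rewrite big_ord_recr; exact: h1.
rewrite big_ord_recr (eq_bigr (fun j : 'I_N =>
  (\sum_(k < K) a k j + a K j) * h ^+ j)); first exact: h2.
by move=> j _; rewrite big_ord_recr.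
Qed.

Lemma cauchy_prod_sum a b h N :
  \sum_(n < N) (\sum_(i < n.+1) a i * b (n - i)%N) * h ^+ n =
  \sum_(i < N) a i * h ^+ i * \sum_(j < N - i) b j * h ^+ j.
Proof.
elim: N => [|N ih]; first by rewrite !big_ord0.
rewrite big_ord_recr ih /= mulr_suml [in RHS]big_ord_recr [X in _ + X = _]big_ord_recr /=.
rewrite subSnn !subnn big_ord1 !expr0 mulr1 addrA.
congr (_ + _); last by rewrite mulrAC.
rewrite -big_split /=; apply: eq_bigr => i _.
have iN := ltn_ord i.
rewrite subSn ?(ltnW iN) // big_ord_recr /= mulrDr; congr (_ + _).
have -> : h ^+ N = h ^+ i * h ^+ (N - i) by rewrite -exprD subnKC // ltnW.
ring.
Qed.

Lemma succ_le_exp2 n : n.+1%:R <= 2 ^+ n :> R.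
Proof. by rewrite -natrX ler_nat ltn_expl. Qed.

(** The n + 1 products in the n-th Cauchy coefficient cost a factor n + 1 <= 2^n, absorbed by
    doubling A. *)
Lemma taylor_atM f g z a b M M' A r : 0 < r -> 0 <= A -> 0 <= M -> 0 <= M' ->
  taylor_at f z a M A r -> taylor_at g z b M' A r ->
  taylor_at (fun s => f s * g s) z (fun n => \sum_(i < n.+1) a i * b (n - i)%N)
    (M * M') (2 * A) r.
Proof.
move=> r0 A0 M0 M0' [f1 f2] [g1 g2].
have MM0 : 0 <= M * M' by rewrite mulr_ge0.
split => [n|N h hr].
  apply: le_trans (ler_cabs_sum _ _ _) _.
  apply: le_trans (_ : \sum_(i < n.+1) M * M' * A ^+ n <= _).
    apply: ler_sum => i _; rewrite cabsM.
    have -> : M * M' * A ^+ n = (M * A ^+ i) * (M' * A ^+ (n - i)).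
      by rewrite mulrACA -exprD subnKC // -ltnS.
    by apply: ler_pM; rewrite ?cabs_ge0.
  rewrite sumr_const card_ord -[leLHS]mulr_natr -mulrA ler_wpM2l //.
  by rewrite exprMn mulrC ler_wpM2r ?exprn_ge0 ?succ_le_exp2.
have ch := cabs_ge0 h.
set B := A * cabs h; have B0 : 0 <= B by rewrite mulr_ge0.
rewrite cauchy_prod_sum.
have -> : f (z + h) * g (z + h) - \sum_(i < N) a i * h ^+ i * \sum_(j < N - i) b j * h ^+ j =
  (f (z + h) - \sum_(i < N) a i * h ^+ i) * g (z + h) +
  \sum_(i < N) a i * h ^+ i * (g (z + h) - \sum_(j < N - i) b j * h ^+ j).
  rewrite mulrBl mulr_suml.
  under [X in _ = _ + X]eq_bigr do rewrite mulrBr.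
  by rewrite sumrB addrA subrK.
apply: le_trans (ler_cabsD _ _) _.
apply: le_trans (_ : M * M' * B ^+ N + \sum_(i < N) M * M' * B ^+ N <= _).
  apply: lerD.
    rewrite cabsM mulrAC; apply: ler_pM; rewrite ?cabs_ge0 ?f2 //.
    by have := g2 0%N h hr; rewrite big_ord0 subr0 expr0 mulr1.
  apply: le_trans (ler_cabs_sum _ _ _) _; apply: ler_sum => i _.
  have -> : M * M' * B ^+ N = (M * B ^+ i) * (M' * B ^+ (N - i)).
    by rewrite mulrACA -exprD subnKC // ltnW.
  rewrite cabsM; apply: ler_pM; rewrite ?cabs_ge0 ?g2 //.
  by rewrite cabsM cabsX exprMn mulrA ler_wpM2r ?exprn_ge0.
rewrite sumr_const card_ord -mulrS -[leLHS]mulr_natr -mulrA ler_wpM2l //.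
rewrite [2 * A * _](_ : _ = 2 * B); last by rewrite /B mulrA.
by rewrite [(2 * B) ^+ N]exprMn mulrC ler_wpM2r ?exprn_ge0 ?succ_le_exp2.
Qed.

(** From (|l| e)^n / n! <= exp(|l| e), used once for the coefficients and once more for the
    remainder. The radius e is free: for l = - ln n the constant M is n^(-Re z + 2e), still a
    negative power of n when e is small. *)
Lemma taylor_at_exp (l e : R) z : 0 < e ->
  taylor_at (fun s => cexp (s * l%:C)) z
    (fun j => cexp (z * l%:C) * ((j`!%:R)^-1 * l%:C ^+ j))
    (expR (complex.Re z * l + 2 * (`|l| * e))) e^-1 e.
Proof.
move=> e0.
have le0 : 0 <= `|l| * e by rewrite mulr_ge0 // ltW.
have bnd n : `|l| ^+ n / n`!%:R <= expR (`|l| * e) * e^-1 ^+ n.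
  have := expR_ge_fact n le0; rewrite exprMn => h.
  by rewrite exprVn ler_pdivlMr ?exprn_gt0 // mulrAC.
split => [n|N h hr].
  rewrite cabsM cabs_cexp Re_mul_real cabsM cabsV cabs_nat cabsX cabs_real.
  rewrite expRD -mulrA ler_wpM2l ?expR_ge0 // mulrC.
  apply: le_trans (bnd n) _; rewrite ler_wpM2r ?exprn_ge0 ?invr_ge0 ?(ltW e0) //.
  by rewrite ler_expR; lra.
have -> : cexp ((z + h) * l%:C) - \sum_(j < N) cexp (z * l%:C) * (j`!%:R^-1 * l%:C ^+ j) * h ^+ j
  = cexp (z * l%:C) * (cexp (h * l%:C) - \sum_(j < N) j`!%:R^-1 * (h * l%:C) ^+ j).
  rewrite mulrBr mulrDl cexpD mulr_sumr; congr (_ - _); apply: eq_bigr => j _.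
  by rewrite [(h * _) ^+ _]exprMn; ring.
rewrite cabsM cabs_cexp Re_mul_real expRD -mulrA ler_wpM2l ?expR_ge0 //.
apply: le_trans (cexp_taylor _ _) _.
have ch := cabs_ge0 h.
rewrite cabsM cabs_real mulr_natl mulr2n expRD !exprMn.
have b1 := bnd N.
have b2 : expR (cabs h * `|l|) <= expR (`|l| * e).
  by rewrite ler_expR mulrC ler_wpM2l // ltW.
have -> : cabs h ^+ N * `|l| ^+ N / N`!%:R * expR (cabs h * `|l|) =
  (`|l| ^+ N / N`!%:R) * expR (cabs h * `|l|) * cabs h ^+ N by ring.
have -> : expR (`|l| * e) * expR (`|l| * e) * (e^-1 ^+ N * cabs h ^+ N) =
  (expR (`|l| * e) * e^-1 ^+ N) * expR (`|l| * e) * cabs h ^+ N by ring.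
rewrite ler_wpM2r ?exprn_ge0 //; by apply: ler_pM; rewrite ?expR_ge0.
Qed.

Lemma cexp_sub1_le w : cabs (cexp w - 1) <= cabs w * expR (cabs w).
Proof.
have := cexp_taylor w 1.
by rewrite big_ord1 fact0 invr1 expr0 mulr1 expr1 (_ : 1`! = 1%N) // divr1.
Qed.

(** What matters is the factor l in M: it is the decay gained by grouping two consecutive terms of
    the alternating series. *)
Lemma taylor_at_exp_sub1 (l : R) z : 0 <= l -> l <= 1 ->
  taylor_at (fun s => cexp (s * l%:C) - 1) z
    (fun j => cexp (z * l%:C) * ((j`!%:R)^-1 * l%:C ^+ j) - (j == 0%N)%:R)
    (l * ((cabs z + 1) * expR (cabs z + 1))) 1 1.
Proof.
move=> l0 l1; have cz := cabs_ge0 z.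
have small w c : cabs w <= c -> cabs (cexp (w * l%:C) - 1) <= l * (c * expR c).
  move=> wc; have cw := cabs_ge0 w; apply: le_trans (cexp_sub1_le _) _.
  rewrite cabsM cabs_real ger0_norm // mulrAC [leRHS]mulrC.
  rewrite ler_wpM2r //; apply: ler_pM; rewrite ?expR_ge0 // ler_expR.
  by apply: le_trans wc; rewrite ler_piMr.
have zl : expR (complex.Re z * l) <= expR (cabs z).
  rewrite ler_expR; apply: le_trans (_ : cabs z * l <= _).
    by rewrite ler_wpM2r // Re_le_cabs.
  by rewrite ler_piMr.
have lX n : l ^+ n.+1 / n.+1`!%:R <= l.
  rewrite ler_pdivrMr ?ltr0n ?fact_gt0 //.
  apply: le_trans (_ : l * 1 <= _); last by rewrite ler_wpM2l // ler1n fact_gt0.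
  by rewrite mulr1 exprS ler_piMr // exprn_ile1.
have c1 : 1 <= cabs z + 1 by lra.
have ee : expR (cabs z) <= expR (cabs z + 1) by rewrite ler_expR; lra.
have eM : expR (cabs z) <= (cabs z + 1) * expR (cabs z + 1).
  by apply: le_trans ee _; rewrite ler_peMl ?expR_ge0.
split => [[|n]|[|N] h hr]; rewrite ?fact0 ?expr0 ?expr1n ?mul1r ?mulr1.
- by rewrite invr1 !mulr1; apply: small; lra.
- rewrite subr0 cabsM cabs_cexp Re_mul_real cabsM cabsV cabs_nat cabsX cabs_real ger0_norm //.
  rewrite mulrC [_^-1 * _]mulrC; apply: ler_pM; rewrite ?divr_ge0 ?exprn_ge0 ?expR_ge0 //.
  exact: le_trans zl eM.
- rewrite big_ord0 subr0; apply: small.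
  by apply: le_trans (ler_cabsD _ _) _; lra.
have -> : cexp ((z + h) * l%:C) - 1 -
   \sum_(j < N.+1) (cexp (z * l%:C) * (j`!%:R^-1 * l%:C ^+ j) - ((j : nat) == 0%N)%:R) * h ^+ j
  = cexp (z * l%:C) * (cexp (h * l%:C) - \sum_(j < N.+1) j`!%:R^-1 * (h * l%:C) ^+ j).
  under [in LHS]eq_bigr do rewrite mulrBl.
  rewrite sumrB [X in _ - (_ - X)]big_ord_recl [X in _ - (_ - (_ + X))]big1; last first.
    by move=> i _; rewrite mul0r.
  rewrite /= expr0 mulr1 addr0 mulrBr mulrDl cexpD mulr_sumr opprB addrA subrK.
  congr (_ - _); apply: eq_bigr => j _.
  by rewrite [(h * _) ^+ _]exprMn; ring.
rewrite cabsM cabs_cexp Re_mul_real.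
have ch := cabs_ge0 h.
have h2 := cexp_taylor (h * l%:C) N.+1.
have h3 : expR (cabs (h * l%:C)) <= expR 1.
  rewrite ler_expR cabsM cabs_real ger0_norm //.
  by apply: mulr_ile1 => //; exact: ltW.
apply: le_trans (ler_pM (expR_ge0 _) (cabs_ge0 _) zl h2) _.
apply: le_trans (_ : expR (cabs z) * (l ^+ N.+1 / N.+1`!%:R) * expR 1 * cabs h ^+ N.+1 <= _).
  rewrite [leRHS](_ : _ = expR (cabs z) * (cabs (h * l%:C) ^+ N.+1 / N.+1`!%:R * expR 1)).
    by rewrite ler_wpM2l ?expR_ge0 // ler_wpM2l ?divr_ge0 ?exprn_ge0 ?cabs_ge0.
  rewrite cabsM cabs_real [`|l|]ger0_norm // exprMn; ring.
rewrite ler_wpM2r ?exprn_ge0 // mulrAC -expRD mulrC; apply: ler_pM => //.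
  by rewrite divr_ge0 ?exprn_ge0.
by rewrite ler_peMl ?expR_ge0.
Qed.

End TaylorGerms.

(** * Sequences tending to zero and Vitali's theorem *)

Section NullSequences.
Context {R : realType}.
Implicit Types (u v : nat -> R[i]) (e : R).

Definition null_seq u : Prop :=
  forall e, 0 < e -> exists K0, forall K, (K0 <= K)%N -> cabs (u K) <= e.

Lemma null_seq_eq u v : (forall K, u K = v K) -> null_seq u -> null_seq v.
Proof. by move=> uv hu e /hu[K0 hK]; exists K0 => K /hK; rewrite uv. Qed.

Lemma null_seqD u v : null_seq u -> null_seq v -> null_seq (fun K => u K + v K).
Proof.
move=> hu hv e e0; have e20 : 0 < e / 2 by lra.
have [K1 h1] := hu _ e20; have [K2 h2] := hv _ e20.
exists (maxn K1 K2) => K; rewrite geq_max => /andP[/h1 a /h2 b].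
by apply: le_trans (ler_cabsD _ _) _; lra.
Qed.

Lemma null_seqZ u (c : R[i]) : null_seq u -> null_seq (fun K => u K * c).
Proof.
move=> hu e e0; have c0 := cabs_ge0 c; have c1 : 0 < cabs c + 1 by lra.
have [K0 h] := hu _ (divr_gt0 e0 c1); exists K0 => K /h; rewrite ler_pdivlMr // cabsM.
by apply: le_trans; rewrite ler_wpM2l ?cabs_ge0 //; lra.
Qed.

Lemma null_seq_sum (n : nat) (u : nat -> nat -> R[i]) :
  (forall j, (j < n)%N -> null_seq (u ^~ j)) -> null_seq (fun K => \sum_(j < n) u K j).
Proof.
elim: n => [|n ih] h.
  by move=> e e0; exists 0%N => K _; rewrite big_ord0 cabs0 ltW.
apply: (@null_seq_eq (fun K => \sum_(j < n) u K j + u K n)).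
  by move=> K; rewrite big_ord_recr.
apply: null_seqD; last exact: h.
by apply: ih => j jn; apply: h; exact: ltnW.
Qed.

Lemma null_seq_cvg (u : nat -> R[i]) (l : R[i]) :
  (u : nat -> R[i]^o) @ \oo --> (l : R[i]^o) -> null_seq (fun K => l - u K).
Proof.
move=> /cvgrPdist_le h e e0.
have e0' : 0 < e%:C by rewrite ltcR.
have [N _ hN] := h _ e0'; exists N => K NK.
by have := hN K NK; rewrite /= cabsE lecR.
Qed.

(* Vitali's theorem: uniform Taylor bounds turn convergence to 0 along a short
   segment starting at z into convergence to 0 of every Taylor coefficient. *)
Lemma null_seq_taylor (D : nat -> R[i] -> R[i]) z (a : nat -> nat -> R[i]) (M A r t : R)
    (d : R[i]) : 0 < r -> 0 < A -> 0 <= M -> 0 < t -> d != 0 ->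
  (forall K, taylor_at (D K) z (a K) M A r) ->
  (forall x, 0 < x < t -> null_seq (fun K => D K (z + x%:C * d))) ->
  exists2 rho, 0 < rho & forall h, cabs h < rho -> null_seq (fun K => D K (z + h)).
Proof.
move=> r0 A0 M0 t0 d0 hD hseg.
have cd : 0 < cabs d by rewrite cabs_gt0.
have ha n : null_seq (a ^~ n).
  elim/ltn_ind: n => n ih e e0.
  have B0 : 0 < M * A ^+ n.+1 + 1 by rewrite ltr_wpDl // mulr_ge0 // exprn_ge0 // ltW.
  (* A point h of the segment within the radius and so close to z that the remainder of order n + 1,
     divided by |h|^n, is at most e/2; the + 1 keeps the divisor positive when M = 0. *)
  pose x := Num.min (t / 2) (Num.min (r / 2) (e / 2 / (M * A ^+ n.+1 + 1)) / cabs d).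
  have x0 : 0 < x by rewrite !lt_min !divr_gt0 // lt_min !divr_gt0.
  have xt : x < t by rewrite gt_min; apply/orP; left; lra.
  pose h := x%:C * d.
  have ch : cabs h = x * cabs d by rewrite cabsM cabs_real gtr0_norm.
  have ch0 : 0 < cabs h by rewrite ch mulr_gt0.
  have hh : cabs h <= Num.min (r / 2) (e / 2 / (M * A ^+ n.+1 + 1)).
    by rewrite ch -ler_pdivlMr // ge_min lexx orbT.
  have hr : cabs h < r.
    by apply: le_lt_trans hh _; rewrite gt_min; apply/orP; left; lra.
  have he : M * A ^+ n.+1 * cabs h <= e / 2.
    apply: le_trans (_ : (M * A ^+ n.+1 + 1) * cabs h <= _).
      by rewrite ler_wpM2r ?cabs_ge0 //; lra.
    by rewrite mulrC -ler_pdivlMr //; apply: le_trans hh _; rewrite ge_min lexx orbT.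
  have nul : null_seq (fun K => D K (z + h) - \sum_(j < n) a K j * h ^+ j).
    apply: null_seqD; first by apply: hseg; rewrite x0.
    apply: (@null_seq_eq (fun K => (\sum_(j < n) a K j * h ^+ j) * (-1))).
      by move=> K; rewrite mulrN1.
    apply: null_seqZ.
    apply: (@null_seq_sum n (fun K j => a K j * h ^+ j)) => j jn.
    by apply: null_seqZ; exact: ih.
  have hn0 : 0 < cabs h ^+ n by rewrite exprn_gt0.
  have eps : 0 < e / 2 * cabs h ^+ n by rewrite mulr_gt0 // divr_gt0.
  have [K0 hK] := nul _ eps; exists K0 => K /hK bK.
  have [_ /(_ n.+1 h hr)] := hD K.
  rewrite big_ord_recr /= [(A * _) ^+ _]exprMn => rem.
  rewrite -(ler_pM2r hn0) -cabsX -cabsM.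
  set S := \sum_(j < n) _ in bK rem.
  have -> : a K n * h ^+ n = (D K (z + h) - S) - (D K (z + h) - (S + a K n * h ^+ n)).
    by ring.
  apply: le_trans (ler_cabsB _ _) _.
  apply: le_trans (lerD bK rem) _.
  rewrite cabsX mulrA [cabs h ^+ n.+1]exprS mulrA -mulrDl ler_wpM2r ?(ltW hn0) //; lra.
(* For |h| < 1/(2A) the remainder of order N is at most M 2^-N uniformly in K, so finitely many
   coefficients decide. *)
exists (Num.min r (A^-1 / 2)).
  by rewrite lt_min r0 divr_gt0 // invr_gt0.
move=> h; rewrite lt_min => /andP[hr hA] e e0.
have ch := cabs_ge0 h.
have Ah : A * cabs h <= 2^-1.
  by rewrite mulrC -ler_pdivlMr // mulrC ltW.
have M10 : 0 < M + 1 by lra.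
pose N := (Num.truncn ((M + 1) / (e / 2))).+1.
have hN : M * (A * cabs h) ^+ N <= e / 2.
  have e20 : 0 < e / 2 by lra.
  have h1 : (M + 1) / (e / 2) < N%:R by exact: truncnS_gt.
  have h2 : N%:R <= 2 ^+ N :> R by apply: le_trans (succ_le_exp2 N); rewrite ler_nat.
  have h3 : (A * cabs h) ^+ N <= 2^-1 ^+ N.
    by rewrite lerXn2r ?nnegrE // mulr_ge0 // ltW.
  apply: le_trans (ler_wpM2l M0 h3) _.
  rewrite exprVn ler_pdivrMr ?exprn_gt0 //.
  move: h1; rewrite ltr_pdivrMr // => h1.
  have : N%:R * (e / 2) <= 2 ^+ N * (e / 2) by rewrite ler_wpM2r // ltW.
  rewrite [e / 2 * _]mulrC; lra.
have nul : null_seq (fun K => \sum_(j < N) a K j * h ^+ j).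
  by apply: (@null_seq_sum N (fun K j => a K j * h ^+ j)) => j jn; exact: null_seqZ.
have e20 : 0 < e / 2 by lra.
have [K0 hK] := nul _ e20; exists K0 => K /hK bK.
have [_ /(_ N h hr) rem] := hD K.
have -> : D K (z + h) = (D K (z + h) - \sum_(j < N) a K j * h ^+ j) +
  \sum_(j < N) a K j * h ^+ j by rewrite subrK.
by apply: le_trans (ler_cabsD _ _) _; lra.
Qed.

End NullSequences.

(** * Analytic germs *)

Section Germs.
Context {R : realType}.
Implicit Types (f g : R[i] -> R[i]) (z w : R[i]) (M A r : R).

Definition germ f z : Prop := exists a M A r,
  [/\ 0 <= M, 0 < A, 0 < r & taylor_at f z a M A r].

Lemma germ_eq f g z : (forall s, f s = g s) -> germ f z -> germ g z.
Proof.
by move=> fg [a [M [A [r [? ? ? h]]]]]; exists a, M, A, r; split => //; apply: taylor_at_eq h.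
Qed.

Lemma germ_common f g z : germ f z -> germ g z -> exists a b M A r,
  [/\ 0 <= M, 0 < A, 0 < r, taylor_at f z a M A r & taylor_at g z b M A r].
Proof.
move=> [a [M1 [A1 [r1 [M10 A10 r10 h1]]]]] [b [M2 [A2 [r2 [M20 A20 r20 h2]]]]].
exists a, b, (Num.max M1 M2), (Num.max A1 A2), (Num.min r1 r2); split.
- by rewrite le_max M10.
- by rewrite lt_max A10.
- by rewrite lt_min r10.
- by apply: taylor_at_weaken h1; rewrite ?le_max ?ge_min ?lexx // ltW.
- by apply: taylor_at_weaken h2; rewrite ?le_max ?ge_min ?lexx ?orbT // ltW.
Qed.

Lemma germD f g z : germ f z -> germ g z -> germ (fun s => f s + g s) z.
Proof.
move=> hf hg; have [a [b [M [A [r [M0 A0 r0 h1 h2]]]]]] := germ_common hf hg.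
exists (fun n => a n + b n), (M + M), A, r; split => //; first by rewrite addr_ge0.
exact: taylor_atD.
Qed.

Lemma germN f z : germ f z -> germ (fun s => - f s) z.
Proof.
move=> [a [M [A [r [M0 A0 r0 h]]]]].
by exists (fun n => - a n), M, A, r; split => //; exact: taylor_atN.
Qed.

Lemma germM f g z : germ f z -> germ g z -> germ (fun s => f s * g s) z.
Proof.
move=> hf hg; have [a [b [M [A [r [M0 A0 r0 h1 h2]]]]]] := germ_common hf hg.
exists (fun n => \sum_(i < n.+1) a i * b (n - i)%N), (M * M), (2 * A), r.
split => //; [by rewrite mulr_ge0|by rewrite mulr_gt0|].
by apply: taylor_atM => //; exact: ltW.
Qed.

Lemma germ_cst (c : R[i]) z : germ (fun=> c) z.
Proof.
exists (fun n => if n == 0%N then c else 0), (cabs c), 1, 1; split => //.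
  exact: cabs_ge0.
split => [[|n]|[|N] h hr]; rewrite ?expr1n ?mulr1 //=.
- by rewrite cabs0 cabs_ge0.
- by rewrite big_ord0 subr0 ?expr0 ?mulr1.
rewrite big_ord_recl big1 => [|i _]; last by rewrite /= mul0r.
by rewrite ?expr0 ?mulr1 addr0 subrr cabs0 mulr_ge0 ?cabs_ge0 // exprn_ge0 // mulr_ge0 ?cabs_ge0.
Qed.

Lemma germ_exp (l : R) z : germ (fun s => cexp (s * l%:C)) z.
Proof.
have h := taylor_at_exp l z (ltr01 : 0 < 1 :> R).
by do 4 eexists; split; last exact: h; rewrite ?invr1 ?expR_ge0.
Qed.

(** Bounded a_n rho^n dominate the series geometrically; on |h| < rho/2 the ratio is at most 1/2 and
    a tail is at most twice its first bound, whence 2B. *)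
Lemma germ_analytic f z : analytic_at f z -> germ f z.
Proof.
move=> [a [r [r0 ha]]].
pose rho := r / 2; have rho0 : 0 < rho by rewrite /rho; lra.
have cr : cabs (z + rho%:C - z) < r.
  rewrite [z + _ - z](_ : _ = rho%:C); last by ring.
  by rewrite cabs_real gtr0_norm // /rho; lra.
(* A Cauchy bound without contour integrals: at z + rho the partial sums stay at bounded distance
   from their limit, and each term is a difference of two of them. *)
have [B B0 hB] : exists2 B, 0 <= B & forall n, cabs (a n) * rho ^+ n <= B.
  have /null_seq_cvg/(_ 1 ltr01)[K0 hK] := ha _ cr.
  set l := f _ in hK; pose S K := series (fun n => a n * (z + rho%:C - z) ^+ n : R[i]^o) K.
  pose C := \sum_(i < K0) cabs (l - S i) + 1.
  have sum0 : 0 <= \sum_(i < K0) cabs (l - S i) by apply: sumr_ge0 => i _; exact: cabs_ge0.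
  have hC K : cabs (l - S K) <= C.
    have [kK|kK] := leqP K0 K.
      by apply: le_trans (hK _ kK) _; rewrite /C; lra.
    rewrite /C (bigD1 (Ordinal kK)) //= -addrA lerDl addr_ge0 //.
    by apply: sumr_ge0 => i _; exact: cabs_ge0.
  exists (C + C) => [|n]; first by rewrite /C; lra.
  have -> : cabs (a n) * rho ^+ n = cabs ((l - S n) - (l - S n.+1)).
    have aux (x y t : R[i]) : x - t - (x - (t + y)) = y by ring.
    rewrite /S !seriesEnat /= big_nat_recr //= aux [z + _ - z](_ : _ = rho%:C); last by ring.
    by rewrite cabsM cabsX cabs_real gtr0_norm.
  by apply: le_trans (ler_cabsB _ _) _; rewrite lerD.
have rV0 : 0 < rho^-1 by rewrite invr_gt0.
have an n : cabs (a n) <= B * rho^-1 ^+ n.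
  by rewrite exprVn ler_pdivlMr ?exprn_gt0.
exists a, (2 * B), rho^-1, (rho / 2); split; rewrite ?mulr_ge0 ?divr_gt0 //.
split => [n|N h hr].
  apply: le_trans (an n) _; rewrite ler_wpM2r ?exprn_ge0 ?(ltW rV0) //; lra.
have ch := cabs_ge0 h.
set x := rho^-1 * cabs h.
have x0 : 0 <= x by rewrite mulr_ge0 // ltW.
have x12 : x <= 2^-1.
  by rewrite /x mulrC ler_pdivrMr // mulrC ltW.
have hterm n : cabs (a n * h ^+ n) <= B * x ^+ n.
  by rewrite cabsM cabsX /x exprMn mulrA ler_wpM2r ?exprn_ge0.
have geo m : \sum_(i < m) x ^+ i <= 2.
  suff : \sum_(i < m) x ^+ i <= 2 - 2 * 2^-1 ^+ m.
    by move/le_trans; apply; rewrite lerBlDr lerDl mulr_ge0 // exprn_ge0.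
  elim: m => [|m ih]; first by rewrite big_ord0 expr0; lra.
  rewrite big_ord_recr /= exprS.
  have : x ^+ m <= 2^-1 ^+ m by rewrite lerXn2r ?nnegrE.
  by move: ih; lra.
have tail m : cabs (\sum_(N <= n < N + m) a n * h ^+ n) <= 2 * B * x ^+ N.
  apply: le_trans (ler_cabs_sum _ _ _) _.
  rewrite -{1}[N]add0n big_addn addKn big_mkord.
  apply: le_trans (_ : \sum_(i < m) (B * x ^+ N) * x ^+ i <= _).
    apply: ler_sum => i _; apply: le_trans (hterm _) _.
    by rewrite addnC exprD mulrA.
  rewrite -mulr_sumr -[2 * B * _]mulrA [leRHS]mulrC; apply: ler_wpM2l (geo m).
  by rewrite mulr_ge0 // exprn_ge0.
have zh : z + h - z = h by ring.
have ch' : cabs (z + h - z) < r.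
  rewrite zh; apply: lt_le_trans hr _; rewrite /rho; lra.
have hc := null_seq_cvg (ha _ ch').
apply/ler_addgt0Pr => e e0; have [K0 hK] := hc e e0.
have {}hK := hK (N + K0)%N (leq_addl _ _).
move: hK; rewrite seriesEnat /= zh.
rewrite (@big_cat_nat _ _ _ N) ?leq_addr //= big_mkord => hK.
set P := \sum_(j < N) _ in hK *.
have -> : f (z + h) - P = (\sum_(N <= n < N + K0) a n * h ^+ n) +
  (f (z + h) - (P + \sum_(N <= n < N + K0) a n * h ^+ n)) by ring.
by apply: le_trans (ler_cabsD _ _) _; rewrite lerD.
Qed.

End Germs.

(** * The alternating zeta function *)

Section DirichletEta.
Context {R : realType}.
Implicit Types (z w s : R[i]) (x y e : R) (k K n : nat).

(** Two consecutive terms of the alternating series; grouped in this way it converges absolutely for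
    Re s > 0. *)
Definition eta_term k s : R[i] := cpow k.*2.+1%:R (- s) - cpow k.*2.+2%:R (- s).

Lemma ln_nat_ge0 n : 0 <= ln n.+1%:R :> R.
Proof. by rewrite ln_ge0 // ler1n. Qed.

Lemma eta_gap_bounds k :
  0 <= ln k.*2.+2%:R - ln k.*2.+1%:R :> R /\ ln k.*2.+2%:R - ln k.*2.+1%:R <= 1 :> R.
Proof.
have p1 : 0 < k.*2.+1%:R :> R by rewrite ltr0n.
have p2 : 0 < k.*2.+2%:R :> R by rewrite ltr0n.
split; first by rewrite subr_ge0 ler_ln // ler_nat.
rewrite -ln_div // -[leRHS]expRK ler_ln ?posrE ?expR_gt0 ?divr_gt0 //.
apply: le_trans (_ : 2 <= _); last by apply: le_trans (expR_ge1Dx 1); lra.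
by rewrite ler_pdivrMr // -natrM ler_nat; lia.
Qed.

(** The gaps are disjoint, so the sum is at most the total decrease of n^-a from its value 1 at n =
    1. *)
Lemma sum_gap_le (a : R) K : 0 <= a ->
  \sum_(k < K) (expR (- a * ln k.*2.+1%:R) - expR (- a * ln k.*2.+2%:R)) <= 1.
Proof.
move=> a0.
suff : \sum_(k < K) (expR (- a * ln k.*2.+1%:R) - expR (- a * ln k.*2.+2%:R))
    <= 1 - expR (- a * ln K.*2.+1%:R).
  by move/le_trans; apply; rewrite gerBl expR_ge0.
elim: K => [|K ih]; first by rewrite big_ord0 ln1 mulr0 expR0 subrr.
rewrite big_ord_recr /= doubleS.
have : expR (- a * ln K.*2.+3%:R) <= expR (- a * ln K.*2.+2%:R).
  by rewrite ler_expR !mulNr lerN2 ler_wpM2l // ler_ln ?posrE ?ltr0n // ler_nat.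
move: ih; lra.
Qed.

(** Each pair factors as exp(-s L) (exp(s l) - 1) with L = ln(2k+2) and l the gap of logarithms. The
    constants multiply to at most a multiple of l exp(-x L / 2), hence of a gap of n^(-x/2), and
    these gaps have bounded sums. *)
Lemma eta_term_taylor z : 0 < complex.Re z -> exists (a : nat -> nat -> R[i]) (M A r : R),
  [/\ 0 <= M, 0 < A, 0 < r &
   forall K, taylor_at (fun s => \sum_(k < K) eta_term k s) z
     (fun n => \sum_(k < K) a k n) M A r].
Proof.
(* The bound x/4 turns the exponent -x + 2e into at most -x/2; the bound 1 fits the radius of
   [taylor_at_exp_sub1]. *)
move=> z0; pose x := complex.Re z; pose e := Num.min (x / 4) 1.
have e0 : 0 < e by rewrite lt_min ltr01 andbT divr_gt0.
have e1 : e <= 1 by rewrite ge_min lexx orbT.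
have ex : e <= x / 4 by rewrite ge_min lexx.
have eV : 1 <= e^-1 by rewrite invf_ge1.
pose L k : R := ln k.*2.+2%:R; pose l k := L k - ln k.*2.+1%:R.
pose C : R := (cabs z + 1) * expR (cabs z + 1).
have C0 : 0 <= C by rewrite mulr_ge0 ?expR_ge0 // addr_ge0 ?cabs_ge0.
pose b k n := cexp (z * (- L k)%:C) * ((n`!%:R)^-1 * (- L k)%:C ^+ n).
pose c k n := cexp (z * (l k)%:C) * ((n`!%:R)^-1 * (l k)%:C ^+ n) - (n == 0%N)%:R.
pose a k n := \sum_(i < n.+1) b k i * c k (n - i)%N.
pose B k := expR (x * - L k + 2 * (`|- L k| * e)).
have L0 k : 0 <= L k by exact: ln_nat_ge0.
have hl k : 0 <= l k /\ l k <= 1 by exact: eta_gap_bounds.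
have h k : taylor_at (eta_term k) z (a k) (B k * (l k * C)) (2 * e^-1) e.
  have [l0 l1] := hl k.
  apply: (@taylor_at_eq _ (fun s => cexp (s * (- L k)%:C) * (cexp (s * (l k)%:C) - 1))).
    move=> s; rewrite mulrBr mulr1 -cexpD /eta_term /cpow /l /L rmorphB rmorphN /=.
    by congr (cexp _ - cexp _); ring.
  have lC : 0 <= l k * C by rewrite mulr_ge0.
  apply: taylor_atM; rewrite ?invr_ge0 ?expR_ge0 ?(ltW e0) //.
    exact: taylor_at_exp.
  by apply: taylor_at_weaken (taylor_at_exp_sub1 z l0 l1).
have x0 : 0 < x / 2 by rewrite divr_gt0.
have bnd k : B k * (l k * C) <= C / (x / 2) *
    (expR (- (x / 2) * ln k.*2.+1%:R) - expR (- (x / 2) * ln k.*2.+2%:R)).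
  have [l0 l1] := hl k.
  have -> : ln k.*2.+1%:R = L k - l k by rewrite /l; ring.
  have -> : - (x / 2) * (L k - l k) = - (x / 2) * L k + (x / 2) * l k by ring.
  rewrite expRD -/(L k).
  have hB : B k <= expR (- (x / 2) * L k).
    rewrite ler_expR normrN ger0_norm //.
    have : L k * e <= L k * (x / 4) by rewrite ler_wpM2l.
    lra.
  have := expR_ge1Dx (x / 2 * l k); set E1 := expR (x / 2 * l k) => h1.
  set E := expR _ in hB *.
  rewrite mulrAC ler_pdivlMr //.
  apply: le_trans (_ : E * (l k * C) * (x / 2) <= _).
    by rewrite ler_wpM2r ?(ltW x0) // ler_wpM2r // mulr_ge0.
  have -> : E * (l k * C) * (x / 2) = (C * E) * (x / 2 * l k) by ring.
  have -> : C * (E * E1 - E) = (C * E) * (E1 - 1) by ring.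
  apply: ler_wpM2l; first by rewrite mulr_ge0 ?expR_ge0.
  by rewrite lerBrDl.
exists a, (C / (x / 2)), (2 * e^-1), e; split => // [||K].
- by rewrite divr_ge0 // ltW.
- by rewrite mulr_gt0 // invr_gt0.
apply: taylor_at_weaken (taylor_at_sum K h) => //.
- by rewrite mulr_ge0 // invr_ge0 ltW.
- apply: le_trans (_ : C / (x / 2) * \sum_(k < K) (expR (- (x / 2) * ln k.*2.+1%:R)
    - expR (- (x / 2) * ln k.*2.+2%:R)) <= _).
    by rewrite mulr_sumr; apply: ler_sum => k _; exact: bnd.
  by rewrite -[leRHS]mulr1; apply: (ler_wpM2l (divr_ge0 C0 (ltW x0))); exact: sum_gap_le (ltW x0).
- apply: sumr_ge0 => k _; have [lk0 _] := hl k.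
  by apply: mulr_ge0; [exact: expR_ge0|exact: mulr_ge0].
Qed.

Variable zeta : R[i] -> R[i].
Hypothesis hzeta : is_riemann_zeta zeta.

Definition eta_defect K s : R[i] :=
  (1 - cpow 2 (1 - s)) * zeta s - \sum_(k < K) eta_term k s.

(** Subtracting the even terms twice, 2K alternating terms add up to Z(2K) - 2^(1-s) Z(K), with Z
    the partial sums of the zeta series. *)
Lemma eta_defect_far s : 1 < complex.Re s -> null_seq (eta_defect ^~ s).
Proof.
move=> s1; have /null_seq_cvg hs := hzeta.1 s s1.
pose Z K := \sum_(k < K) cpow k.+1%:R (- s).
have ZE K : series (fun n => cpow n.+1%:R (- s) : R[i]^o) K = Z K.
  by rewrite seriesEnat /= big_mkord.
have hZ : null_seq (fun K => zeta s - Z K) by apply: null_seq_eq hs => K; rewrite ZE.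
have hZ2 : null_seq (fun K => zeta s - Z K.*2).
  move=> e /hZ[K0 h]; exists K0 => K K0K; apply: h.
  by rewrite -addnn (leq_trans K0K) // leq_addr.
have p2 : 0 < 2 :> R by [].
have E K : \sum_(k < K) eta_term k s = Z K.*2 - cpow 2 (1 - s) * Z K.
  rewrite cpowD cpow1 //; elim: K => [|K ih].
    by rewrite /Z !big_ord0 mulr0 subrr.
  rewrite big_ord_recr ih doubleS /Z !big_ord_recr /= /eta_term -/(Z _).
  have -> : cpow K.*2.+2%:R (- s) = cpow 2 (- s) * cpow K.+1%:R (- s).
    by rewrite -cpowM ?ltr0n // -natrM mul2n.
  have -> : (2%:R)%:C = 2 :> R[i] by rewrite rmorph_nat.
  rewrite -/(Z _); ring.
apply: (@null_seq_eq _ (fun K => (zeta s - Z K.*2) + (zeta s - Z K) * - cpow 2 (1 - s))).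
  by move=> K; rewrite /eta_defect E; ring.
by apply: null_seqD => //; exact: null_seqZ.
Qed.

Lemma eta_defect_taylor z : 0 < complex.Re z -> z != 1 ->
  exists (a : nat -> nat -> R[i]) (M A r : R),
  [/\ 0 <= M, 0 < A, 0 < r & forall K, taylor_at (eta_defect K) z (a K) M A r].
Proof.
move=> z0 z1.
have [b [M1 [A1 [r1 [M10 A10 r10 hb]]]]] := eta_term_taylor z0.
have [c [M2 [A2 [r2 [M20 A20 r20 hc]]]]] : germ (fun s => (1 - cpow 2 (1 - s)) * zeta s) z.
  apply: germM; last by apply: germ_analytic; exact: hzeta.2.
  apply: (@germ_eq _ (fun s => 1 + - (cpow 2 1 * cexp (s * (- ln 2)%:C)))).
    by move=> s; rewrite cpowD; congr (1 - _ * cexp _); rewrite rmorphN; ring.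
  apply: germD; first exact: germ_cst.
  by apply: germN; apply: germM; [exact: germ_cst|exact: germ_exp].
exists (fun K n => c n + - \sum_(k < K) b k n), (Num.max M1 M2 + Num.max M1 M2),
  (Num.max A1 A2), (Num.min r1 r2); split.
- by rewrite addr_ge0 // le_max M10.
- by rewrite lt_max A10.
- by rewrite lt_min r10.
move=> K; apply: taylor_atD.
  by apply: taylor_at_weaken hc; rewrite ?le_max ?ge_min ?lexx ?orbT // ltW.
by apply: taylor_atN; apply: taylor_at_weaken (hb K); rewrite ?le_max ?ge_min ?lexx // ltW.
Qed.

(* Analytic continuation along the segment from s + 2 +- i to s; the sign is
   chosen so that the segment avoids 1. *)
Lemma eta_defect_null s : 0 < complex.Re s -> s != 1 -> null_seq (eta_defect ^~ s).
Proof.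
move=> s0 s1.
pose sg : R := if 0 <= complex.Im s then 1 else -1.
pose d : R[i] := 2 +i* sg; pose zt t := s + t%:C * d.
have Re_zt t : complex.Re (zt t) = complex.Re s + 2 * t.
  by rewrite /zt /d; case: (s) => u v /=; ring.
have Im_zt t : complex.Im (zt t) = complex.Im s + sg * t.
  by rewrite /zt /d; case: (s) => u v /=; ring.
have d0 : d != 0 by rewrite eq_complex /= pnatr_eq0.
have cd : 0 < cabs d by rewrite cabs_gt0.
have zt1 t : 0 <= t -> zt t != 1.
  rewrite le_eqVlt => /predU1P[<-|t0]; first by rewrite /zt mul0r addr0.
  apply/eqP => /(congr1 (@complex.Im R)); rewrite Im_zt /= /sg.
  by case: ifPn; rewrite -?ltNge; lra.
pose G t := null_seq (eta_defect ^~ (zt t)).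
(* Connectedness through an infimum T: convergence above T spreads to a disc around [zt T], which
   contains [zt T] itself and, if T > 0, parameters below T, against minimality. *)
pose S : set R := [set t | 0 <= t /\ forall t', t < t' -> G t'].
have S1 : S 1.
  split => // t' t1; apply: eta_defect_far; rewrite Re_zt; lra.
have lbS : lbound S 0 by move=> t [].
have hiS : has_inf S by split; [exists 1|exists 0].
pose T := inf S.
have T0 : 0 <= T by apply: lb_le_inf => //; exists 1.
have GT t : T < t -> G t.
  move=> Tt; have [|u [Su hu]] := inf_adherent _ hiS (eps := t - T).
    by rewrite subr_gt0.
  by rewrite addrC subrK => ut; apply: hu.
have zE x : zt (T + x) = zt T + x%:C * d by rewrite /zt rmorphD; ring.
have ReT : 0 < complex.Re (zt T) by rewrite Re_zt; lra.
have [a [M [A [r [M0 A0 r0 hD]]]]] := eta_defect_taylor ReT (zt1 T T0).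
have [x /andP[x0 _]|rho rho0 hrho] := null_seq_taylor r0 A0 M0 ltr01 d0 hD.
  by rewrite -zE; apply: GT; lra.
have [TE|T1] := eqVneq T 0.
  have := hrho 0; rewrite cabs0 addr0 TE /zt mul0r addr0; exact.
exfalso.
have TT : 0 < T by rewrite lt_neqAle eq_sym T1.
pose eta := Num.min T (rho / 2 / cabs d).
have eta0 : 0 < eta by rewrite lt_min TT !divr_gt0.
have : T <= T - eta; last by lra.
apply: ge_inf; first by exists 0.
split; first by rewrite subr_ge0 ge_min lexx.
move=> t ht; have [Tt|tT] := ltP T t; first exact: GT.
rewrite /G (_ : t = T + (t - T)); last by ring.
rewrite zE; apply: hrho; rewrite cabsM cabs_real -ltr_pdivlMr //.
have h1 : eta <= rho / 2 / cabs d by rewrite ge_min lexx orbT.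
have h2 : rho / 2 / cabs d < rho / cabs d by rewrite ltr_pM2r ?invr_gt0 //; lra.
by rewrite ler0_norm; lra.
Qed.

End DirichletEta.

(** * Tails of the alternating series *)

Section AlternatingTail.
Context {R : realType}.
Variable zeta : R[i] -> R[i].
Hypothesis hzeta : is_riemann_zeta zeta.
Implicit Types (s : R[i]) (n m j : nat).

Definition alt_term s m : R[i] := (-1) ^+ m.-1 * cpow m%:R (- s).

Lemma ratio_ge1 s : 0 < complex.Re s -> 1 <= cabs s / complex.Re s.
Proof. by move=> s0; rewrite ler_pdivlMr // mul1r Re_le_cabs. Qed.

Lemma alt_block_le s j n : 0 < complex.Re s ->
  cabs (\sum_(n.+1 <= m < n.+1 + j) alt_term s m) <=
  cabs s / complex.Re s * n.+1%:R `^ (- complex.Re s).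
Proof.
move=> s0; have q1 := ratio_ge1 s0; set q := _ / _ in q1 *.
have q0 : 0 <= q by apply: le_trans q1.
have sgn k (z : R[i]) : cabs ((-1) ^+ k * z) = cabs z.
  by rewrite cabsM cabsX cabsN cabs1 expr1n mul1r.
have tm m : cabs (alt_term s m.+1) = m.+1%:R `^ (- complex.Re s).
  by rewrite sgn cabs_cpow ?ltr0n // raddfN.
(* Two consecutive lengths are carried together, since a step removes a pair of terms. The pairs
   telescope; a lone last term is covered by |s|/sigma >= 1. *)
suff H i : forall n, (cabs (\sum_(n.+1 <= m < n.+1 + i) alt_term s m) <=
    q * n.+1%:R `^ (- complex.Re s)) /\
   (cabs (\sum_(n.+1 <= m < n.+1 + i.+1) alt_term s m) <= q * n.+1%:R `^ (- complex.Re s)).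
  by have [] := H j n.
elim: i => [|i ih] {}n.
  rewrite addn0 addn1 big_geq // big_nat1 cabs0 tm; split.
    by rewrite mulr_ge0 ?powR_ge0.
  by rewrite ler_peMl ?powR_ge0.
split; first by have [] := ih n.
rewrite big_ltn; last by lia.
rewrite big_ltn; last by lia.
have -> : (n.+1 + i.+2 = n.+3 + i)%N by lia.
rewrite addrA; apply: le_trans (ler_cabsD _ _) _.
have [h1 _] := ih n.+2.
have h2 : cabs (alt_term s n.+1 + alt_term s n.+2) <=
    q * (n.+1%:R `^ (- complex.Re s) - n.+2%:R `^ (- complex.Re s)).
  rewrite /alt_term /= exprS mulN1r mulNr -mulrBr sgn.
  by apply: cpow_opp_dist_le; rewrite ?ltr0n ?ler_nat.
have h3 : q * n.+3%:R `^ (- complex.Re s) <= q * n.+2%:R `^ (- complex.Re s).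
  rewrite ler_wpM2l // !powRN lef_pV2 ?posrE ?powR_gt0 ?ltr0n //.
  by rewrite ge0_ler_powR ?nnegrE ?ler_nat // ltW.
move: h1 h2 h3; rewrite mulrBr; lra.
Qed.

Lemma sum_eta_term s K :
  \sum_(k < K) eta_term k s = \sum_(1 <= m < K.*2.+1) alt_term s m.
Proof.
elim: K => [|K ih]; first by rewrite big_ord0 big_geq.
rewrite big_ord_recr ih doubleS [RHS]big_nat_recr //= [X in _ = X + _]big_nat_recr //= -[RHS]addrA; congr (_ + _).
rewrite /alt_term /eta_term /= exprS -signr_odd odd_double expr0; ring.
Qed.

Lemma eta_tail_le s n : 0 < complex.Re s -> s != 1 ->
  cabs ((1 - cpow 2 (1 - s)) * zeta s - \sum_(1 <= m < n.+1) alt_term s m) <=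
  cabs s / complex.Re s * n.+1%:R `^ (- complex.Re s).
Proof.
move=> s0 s1; apply/ler_addgt0Pr => e e0.
(* The block bound does not depend on the length, so it passes to the limit. The index K0 + n
   ensures that 2K terms include the first n. *)
have [K0 hK] := eta_defect_null hzeta s0 s1 e0.
have := hK (K0 + n)%N (leq_addr _ _); rewrite /eta_defect sum_eta_term.
set K := (K0 + n)%N; rewrite (@big_cat_nat _ _ _ n.+1) //=; last by rewrite /K; lia.
have -> : (K.*2.+1 = n.+1 + (K.*2 - n))%N by rewrite /K; lia.
set E := _ * _; set A := \sum_(1 <= _ < _) _; set B := \sum_(_ <= _ < _) _ => h.
have hB : cabs B <= cabs s / complex.Re s * n.+1%:R `^ (- complex.Re s).
  exact: alt_block_le.
have -> : E - A = B + (E - (A + B)) by ring.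
by apply: le_trans (ler_cabsD _ _) _; rewrite lerD.
Qed.

End AlternatingTail.

(** * Lipschitz bound for the kernel *)

Section LipschitzKernel.
Context {R : realType}.
Variable zeta : R[i] -> R[i].
Hypothesis hzeta : is_riemann_zeta zeta.
Variables (s : R[i]) (X : R) (N : nat).
Hypotheses (s0 : 0 < complex.Re s) (s1 : s != 1) (X1 : 1 <= X) (XN : X < N.+1%:R).

(* (1 - s) times the integral over [t, X] of v^-s (eta(s) - the partial sum up
   to X/v of the alternating series), written without integrals. *)
Definition tail_kernel (t : R) : R[i] :=
  (1 - cpow 2 (1 - s)) * zeta s * (cpow X (1 - s) - cpow t (1 - s)) -
  \sum_(1 <= m < N.+1) alt_term s m *
    (cpow (Num.max (X / m%:R) t) (1 - s) - cpow t (1 - s)).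

Lemma tail_kernel_end : tail_kernel X = 0.
Proof.
rewrite /tail_kernel subrr mulr0 big_nat_cond big1 ?subrr // => m /andP[/andP[m1 _] _].
rewrite max_r ?subrr ?mulr0 // ler_pdivrMr ?ltr0n // ler_peMr ?ler1n //.
exact: le_trans X1.
Qed.

(** On [X/(n+2), X/(n+1)] the truncated series has exactly n + 1 terms, so an increment of the
    kernel is one tail times an increment of t^(1-s). The factors (n+2)^-sigma and u^-sigma combine
    into at most X^-sigma because (n+2) u >= X: the constant is the same on all pieces. *)
Lemma tail_kernel_lip a b : 1 <= a -> a <= b -> b <= X ->
  cabs (tail_kernel a - tail_kernel b) <=
  cabs (s - 1) * (cabs s / complex.Re s) * X `^ (- complex.Re s) * (b - a).
Proof.
set L := _ * X `^ _; have X0 : 0 < X by apply: lt_le_trans X1.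
have q0 : 0 <= cabs s / complex.Re s by apply: le_trans (ratio_ge1 s0).
(* The pieces are added from X downwards; n = N reaches down to 1 because X < N + 1. *)
suff H n : (n <= N)%N -> forall x y, X / n.+1%:R <= x -> x <= y -> y <= X ->
    cabs (tail_kernel x - tail_kernel y) <= L * (y - x).
  move=> a1 ab bX; apply: (H N) => //; apply: le_trans a1.
  by rewrite ler_pdivrMr ?ltr0n // mul1r ltW.
elim: n => [|n ih] nN x y hx xy yX.
  move: hx; rewrite divr1 => hx; have -> : y = x by apply/eqP; rewrite eq_le xy (le_trans yX).
  by rewrite !subrr cabs0 mulr0.
have n0 : 0 < n.+1%:R :> R by rewrite ltr0n.
have nn0 : 0 < n.+2%:R :> R by rewrite ltr0n.
have piece u v : X / n.+2%:R <= u -> u <= v -> v <= X / n.+1%:R ->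
    cabs (tail_kernel u - tail_kernel v) <= L * (v - u).
  move=> hu uv hv; have u0 : 0 < u by apply: lt_le_trans hu; rewrite divr_gt0.
  have -> : tail_kernel u - tail_kernel v =
    ((1 - cpow 2 (1 - s)) * zeta s - \sum_(1 <= m < n.+2) alt_term s m) *
      (cpow v (1 - s) - cpow u (1 - s)).
    have cut t : X / n.+2%:R <= t -> t <= X / n.+1%:R ->
        tail_kernel t = (1 - cpow 2 (1 - s)) * zeta s * (cpow X (1 - s) - cpow t (1 - s)) -
        \sum_(1 <= m < n.+2) alt_term s m * (cpow (X / m%:R) (1 - s) - cpow t (1 - s)).
      move=> h1 h2; rewrite /tail_kernel; congr (_ - _).
      rewrite (@big_cat_nat _ _ _ n.+2) //= [X in _ + X]big_nat_cond.
      rewrite [X in _ + X]big1 ?addr0 => [|m /andP[/andP[m1 _] _]].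
        rewrite big_nat_cond [RHS]big_nat_cond; apply: eq_bigr => m /andP[/andP[m1 m2] _].
        rewrite max_l //; apply: le_trans h2 _.
        by rewrite ler_pM2l // lef_pV2 ?posrE ?ltr0n // ler_nat.
      rewrite max_r ?subrr ?mulr0 //; apply: le_trans h1.
      have m0 : (0 < m)%N by apply: leq_trans m1.
      by rewrite ler_pM2l // lef_pV2 ?posrE ?ltr0n // ler_nat.
    rewrite !cut //; [|exact: le_trans uv|exact: le_trans hv].
    set A := _ * zeta s; rewrite [RHS]mulrBl [in RHS]mulr_suml.
    have -> : \sum_(1 <= m < n.+2) alt_term s m * (cpow v (1 - s) - cpow u (1 - s)) =
      \sum_(1 <= m < n.+2) alt_term s m * (cpow (X / m%:R) (1 - s) - cpow u (1 - s)) -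
      \sum_(1 <= m < n.+2) alt_term s m * (cpow (X / m%:R) (1 - s) - cpow v (1 - s)).
      by rewrite -sumrB; apply: eq_bigr => m _; ring.
    ring.
  rewrite cabsM.
  apply: le_trans (ler_pM (cabs_ge0 _) (cabs_ge0 _) (eta_tail_le hzeta n.+1 s0 s1)
    (cpow_dist_le (ltW s0) u0 uv)) _.
  have key : n.+2%:R `^ (- complex.Re s) * u `^ (- complex.Re s) <= X `^ (- complex.Re s).
    rewrite -powRM ?(ltW u0) // !powRN lef_pV2 ?posrE ?powR_gt0 ?mulr_gt0 //.
    rewrite ge0_ler_powR ?nnegrE ?(ltW s0) ?(ltW X0) //; first by rewrite mulr_ge0 ?(ltW u0).
    by rewrite mulrC -ler_pdivrMr.
  rewrite [cabs (1 - s)]cabsC.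
  have -> : cabs s / complex.Re s * n.+2%:R `^ (- complex.Re s) *
     (cabs (s - 1) * u `^ (- complex.Re s) * (v - u)) =
     cabs (s - 1) * (cabs s / complex.Re s) *
       (n.+2%:R `^ (- complex.Re s) * u `^ (- complex.Re s)) * (v - u) by ring.
  by rewrite /L ler_wpM2r ?subr_ge0 // ler_wpM2l // mulr_ge0 ?cabs_ge0.
have ihn := ih (ltnW nN).
have [xn|xn] := leP (X / n.+1%:R) x; first exact: ihn.
have [yn|yn] := leP y (X / n.+1%:R); first exact: piece.
apply: le_trans (ler_cabs_distl _ _ (tail_kernel (X / n.+1%:R))) _.
have h1 := piece _ _ hx (ltW xn) (lexx _).
have h2 := ihn _ _ (lexx _) (ltW yn) yX.
apply: le_trans (lerD h1 h2) _.
by rewrite le_eqVlt; apply/orP; left; apply/eqP; ring.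
Qed.

End LipschitzKernel.

Lemma sum_by_parts (K : comNzRingType) (a H : nat -> K) N :
  \sum_(1 <= d < N.+1) a d * H d =
  \sum_(1 <= n < N) (\sum_(1 <= d < n.+1) a d) * (H n - H n.+1) +
  (\sum_(1 <= d < N.+1) a d) * H N.
Proof.
case: N => [|N]; first by rewrite !big_geq // mul0r addr0.
elim: N => [|N ih]; first by rewrite !big_nat1 big_geq ?add0r.
rewrite big_nat_recr //= ih [in RHS]big_nat_recr //= [X in _ = _ + X * _]big_nat_recr //=.
ring.
Qed.

(** * The estimate *)

Section MainEstimate.
Context {R : realType}.
Variable zeta : R[i] -> R[i].
Hypothesis hzeta : is_riemann_zeta zeta.
Variables (s : R[i]) (X : R) (q : nat).
Hypotheses (s0 : 0 < complex.Re s) (s1 : s != 1) (X1 : 1 <= X) (q0 : (0 < q)%N).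

Let N := Num.truncn X.
Let Q (x : R) : R[i] := cpow x (1 - s).
Let a (d : nat) : R[i] := if coprime d q then (mobius d)%:~R / d%:R else 0.
(** (1 - s)/k times the integral of u^-s over [k, X]; the maximum makes it 0 for k > X, the support
    condition of the Moebius sums. *)
Let F (k : nat) : R[i] := (Q (Num.max X k%:R) - Q k%:R) / k%:R.
Let S : R[i] := \sum_(1 <= n < N.+1 | coprime n q) (mobius n)%:~R / cpow n%:R s.
Let eta : R[i] := (1 - cpow 2 (1 - s)) * zeta s.
Let H := tail_kernel zeta s X N.

Let X0 : 0 < X. Proof. exact: lt_le_trans X1. Qed.
Let NX : N%:R <= X. Proof. by rewrite truncn_le ltW. Qed.
Let XN : X < N.+1%:R. Proof. exact: truncnS_gt. Qed.

Let Q_nat (d : nat) : (0 < d)%N -> Q d%:R = d%:R * cpow d%:R (- s).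
Proof. by move=> d0; rewrite /Q cpowD cpow1 ?ltr0n // rmorph_nat. Qed.

Let QM (m : nat) (x : R) : (0 < m)%N -> 0 < x -> Q (m%:R * x) = m%:R * cpow m%:R (- s) * Q x.
Proof. by move=> m0 x0; rewrite {1}/Q cpowM ?ltr0n // -/(Q _) -/(Q _) Q_nat. Qed.

Lemma mq_nat n : (mq q n%:R)%:C = \sum_(1 <= d < n.+1) a d.
Proof.
rewrite /mq natrK [RHS](_ : _ = \sum_(1 <= d < n.+1 | coprime d q) (mobius d)%:~R / d%:R);
  last by rewrite [RHS]big_mkcond.
rewrite rmorph_sum; apply: eq_bigr => d _.
by rewrite rmorphM /= fmorphV rmorph_int rmorph_nat.
Qed.

Lemma mq_trunc : mq q X = mq q N%:R.
Proof. by rewrite /mq natrK. Qed.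

Let F_vanish k : (N < k)%N -> F k = 0.
Proof.
move=> Nk; rewrite /F max_r ?subrr ?mul0r //; apply: ltW; apply: lt_le_trans XN _.
by rewrite ler_nat.
Qed.

(** The part of [H] with eta gives S, since a_d d^(1-s) = mu_q(d) d^-s. In the truncated part
    max(X/m, d) = max(X, d m)/m, so each term is mu_q(d) (-1)^(m-1) F(d m). *)
Lemma kernel_sum :
  \sum_(1 <= d < N.+1) a d * H d%:R =
  eta * ((mq q X)%:C * Q X - S) -
  \sum_(1 <= k < N.+1 | smooth (primes q) k) (F k - 2 * F (2 * k)%N).
Proof.
rewrite -(sum_mobius_mul_alt q0 F_vanish) mq_trunc mq_nat.
have -> : S = \sum_(1 <= d < N.+1) a d * Q d%:R.
  rewrite /S big_mkcond big_nat_cond [RHS]big_nat_cond.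
  apply: eq_bigr => d /andP[/andP[d0 _] _]; rewrite /a.
  case: ifP => _; last by rewrite mul0r.
  rewrite Q_nat // cpowN mulrA divfK // pnatr_eq0; lia.
rewrite mulr_suml -sumrB mulr_sumr [X in _ = _ - X]big_mkcond -sumrB.
rewrite big_nat_cond [RHS]big_nat_cond.
apply: eq_bigr => d /andP[/andP[d0 _] _]; rewrite /H /tail_kernel -/eta mulrBr.
congr (_ - _); first by rewrite /Q; ring.
rewrite /a; case: ifP => _; last by rewrite mul0r.
rewrite -mulrA; congr (_ * _); rewrite mulr_sumr.
rewrite big_nat_cond [RHS]big_nat_cond; apply: eq_bigr => m /andP[/andP[m0 _] _].
have m0r : 0 < m%:R :> R by rewrite ltr0n.
have d0r : 0 < d%:R :> R by rewrite ltr0n.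
have e1 : Num.max X (d * m)%:R = m%:R * Num.max (X / m%:R) d%:R.
  by rewrite maxr_pMr ?ltW // mulrCA mulfV ?gt_eqF // mulr1 natrM [d%:R * _]mulrC.
rewrite /F e1 QM //; last by rewrite lt_max d0r orbT.
rewrite natrM [d%:R * m%:R]mulrC QM // /alt_term /Q.
have mC : m%:R != 0 :> R[i] by rewrite pnatr_eq0 -lt0n.
have dC : d%:R != 0 :> R[i] by rewrite pnatr_eq0 -lt0n.
by field; rewrite ?natrM ?mulf_neq0 ?mC ?dC.
Qed.

(** The integral of |m_q| over [1, X], as m_q is constant between consecutive integers; see
    [integral_mq]. *)
Definition abs_sum : R :=
  \sum_(1 <= n < N) `|mq q n%:R| + `|mq q N%:R| * (X - N%:R).

(** Abel summation. As H(X) = 0, the boundary term is m_q(N) (H(N) - H(X)), an increment over the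
    last, incomplete interval [N, X]. *)
Lemma kernel_sum_le :
  cabs (\sum_(1 <= d < N.+1) a d * H d%:R) <=
  cabs (s - 1) * (cabs s / complex.Re s) * X `^ (- complex.Re s) * abs_sum.
Proof.
set L := _ * X `^ _.
have N1 : (1 <= N)%N by rewrite /N truncn_gt0.
have HX : H X = 0 by exact: tail_kernel_end.
rewrite (sum_by_parts a (fun d => H d%:R)) -[H N%:R]subr0 -[X in _ * (_ - X)]HX.
apply: le_trans (ler_cabsD _ _) _; rewrite /abs_sum [leRHS]mulrDr; apply: lerD; last first.
  rewrite cabsM -mq_nat cabs_real mulrCA ler_wpM2l //.
  by apply: tail_kernel_lip => //; rewrite ler1n.
apply: le_trans (ler_cabs_sum _ _ _) _; rewrite mulr_sumr.
rewrite big_nat_cond [leRHS]big_nat_cond; apply: ler_sum => n /andP[/andP[n1 nN] _].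
rewrite cabsM -mq_nat cabs_real mulrC ler_wpM2r //.
have := tail_kernel_lip hzeta s0 s1 X1 XN (a := n%:R) (b := n.+1%:R).
have -> : n.+1%:R - n%:R = 1 :> R by rewrite -addn1 natrD; ring.
rewrite -/H -/L mulr1; apply.
- by rewrite ler1n.
- by rewrite ler_nat.
- by apply: le_trans NX; rewrite ler_nat.
Qed.

Let G (k : nat) : R[i] := (Q (Num.max X (2 * k%:R)) - Q X) / k%:R.

(** Replacing X by 2k as endpoint leaves ((2k)^(1-s) - k^(1-s))/k = (2^(1-s) - 1) k^-s; [G] corrects
    this replacement and is 0 unless 2k > X. *)
Lemma smooth_sum_F :
  \sum_(1 <= k < N.+1 | smooth (primes q) k) (F k - 2 * F (2 * k)%N) =
  - ((s - 1) * cfun s * smooth_sum (primes q) s N) -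
  \sum_(1 <= k < N.+1 | smooth (primes q) k) G k.
Proof.
have cs : (s - 1) * cfun s = 1 - cpow 2 (1 - s).
  by rewrite /cfun (negbTE s1) mulrC divfK // subr_eq0.
rewrite cs /smooth_sum mulr_sumr -opprD -big_split -sumrN /=.
rewrite big_nat_cond [RHS]big_nat_cond; apply: eq_bigr => k /andP[/andP[k0 kN] _].
have k0r : 0 < k%:R :> R by rewrite ltr0n.
have kC : k%:R != 0 :> R[i] by rewrite pnatr_eq0 -lt0n.
have kX : k%:R <= X by apply: le_trans NX; rewrite ler_nat -ltnS.
rewrite /F /G (max_l kX) natrM [Q k%:R]Q_nat //.
have -> : Q (2%:R * k%:R) = cpow 2 (1 - s) * (k%:R * cpow k%:R (- s)).
  by rewrite /Q cpowM // -/(Q k%:R) Q_nat.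
have -> : (2 * k)%:R = 2 * k%:R :> R[i] by rewrite natrM.
by field.
Qed.

Variable sigma0 : R.
Hypothesis sigma00 : 0 < sigma0.
Let w := complex.Re s - sigma0.
(** In the excluded case w = 0, q > 1 the Euler product at w vanishes and the final bound is +oo. *)
Hypothesis hw : 0 < w \/ primes q = [::].

Let powk (k : nat) : (0 < k)%N ->
  k%:R `^ (- complex.Re s) = k%:R `^ (- w) * k%:R `^ (- sigma0) :> R.
Proof.
move=> k0; rewrite -powRD; first by congr (_ `^ _); rewrite /w; ring.
by rewrite pnatr_eq0 -lt0n k0 implybT.
Qed.

Lemma efun_ge0 : 0 <= efun s.
Proof.
have l2 : 0 <= ln 2 :> R by rewrite ln_ge0 // ler1n.
by rewrite /efun !mulr_ge0 ?powR_ge0 // addr_ge0 // !mulr_ge0 ?powR_ge0 ?cabs_ge0.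
Qed.

Let coef_ge0 : 0 <= cabs (s - 1) * (2 `^ sigma0 * efun s) * X `^ (- sigma0).
Proof.
have := efun_ge0; move: (efun s) => E E0.
by rewrite !mulr_ge0 ?powR_ge0 ?cabs_ge0.
Qed.

(** Only k >= X/2 contribute, and then k^-sigma0 <= 2^sigma0 X^-sigma0: this is the factor 2^sigma0
    of the bound. *)
Lemma G_le (k : nat) : (0 < k)%N -> (k <= N)%N ->
  cabs (G k) <= cabs (s - 1) * (2 `^ sigma0 * efun s) * X `^ (- sigma0) * k%:R `^ (- w).
Proof.
move=> k0 kN; have k0r : 0 < k%:R :> R by rewrite ltr0n.
have kX : k%:R <= X by apply: le_trans NX; rewrite ler_nat.
have e0 := efun_ge0.
have [Xk|Xk] := leP X (2 * k%:R); last first.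
  rewrite /G max_l ?(ltW Xk) // subrr mul0r cabs0.
  by rewrite mulr_ge0 ?coef_ge0 ?powR_ge0.
rewrite /G max_r // cabsM cabsV cabs_nat ler_pdivrMr //.
apply: le_trans (cpow_dist_double_le s k0r kX Xk) _.
have -> : k%:R `^ (1 - complex.Re s) = k%:R * (k%:R `^ (- w) * k%:R `^ (- sigma0)).
  rewrite -powk // powRD ?powRr1 ?ler0n //.
  by rewrite pnatr_eq0 -lt0n k0 implybT.
have key : k%:R `^ (- sigma0) <= 2 `^ sigma0 * X `^ (- sigma0).
  have -> : 2 `^ sigma0 * X `^ (- sigma0) = (X / 2) `^ (- sigma0).
    rewrite powRM ?invr_ge0 ?(ltW X0) // mulrC -powR_inv1 // -powRrM.
    by congr (_ * _ `^ _); ring.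
  have X2 : X / 2 <= k%:R by rewrite ler_pdivrMr // mulrC.
  rewrite !powRN lef_pV2 ?posrE ?powR_gt0 ?divr_gt0 //.
  by rewrite ge0_ler_powR ?nnegrE ?(ltW sigma00) ?divr_ge0 ?(ltW X0).
have h : k%:R `^ (- sigma0) * (k%:R * k%:R `^ (- w) * cabs (s - 1) * efun s) <=
  2 `^ sigma0 * X `^ (- sigma0) * (k%:R * k%:R `^ (- w) * cabs (s - 1) * efun s).
  rewrite ler_wpM2r // mulr_ge0 // mulr_ge0 ?cabs_ge0 // mulr_ge0 ?powR_ge0 //.
apply: le_trans (le_trans _ h) _.
  by rewrite le_eqVlt; apply/orP; left; apply/eqP; ring.
by rewrite le_eqVlt; apply/orP; left; apply/eqP; ring.
Qed.

Lemma main_estimate : zeta s != 0 ->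
  cabs (S - (mq q X)%:C / cpow X (s - 1) - (euler_prod (primes q) s)^-1 / zeta s)
    * (cabs (cfun s) * cabs (zeta s)) <=
  cabs s / complex.Re s * X `^ (- complex.Re s) * abs_sum +
  (cabs (cfun s) + 2 `^ sigma0 * efun s) * X `^ (- sigma0) *
    (\prod_(p <- primes q) (1 - p%:R `^ (- w)))^-1.
Proof.
move=> z0.
set Ls := (euler_prod _ _)^-1; set Lw := (\prod_(_ <- _) _)^-1.
set D := S - _ - _.
have cs : (s - 1) * cfun s = 1 - cpow 2 (1 - s).
  by rewrite /cfun (negbTE s1) mulrC divfK // subr_eq0.
have s1' : 0 < cabs (s - 1) by rewrite cabs_gt0 subr_eq0.
have DE : (s - 1) * (cfun s * zeta s) * D =
   - \sum_(1 <= d < N.+1) a d * H d%:R +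
   \sum_(1 <= k < N.+1 | smooth (primes q) k) G k -
   (s - 1) * cfun s * (Ls - smooth_sum (primes q) s N).
  have hQ : (cpow X (s - 1))^-1 = Q X by rewrite -cpowN opprB.
  rewrite kernel_sum smooth_sum_F /D hQ /eta -cs.
  move: (\sum_(_ <= _ < _ | _) G _) (smooth_sum _ _ _) ((mq q X)%:C) => g t m.
  by field.
rewrite -(ler_pM2l s1').
have -> : cabs (s - 1) * (cabs D * (cabs (cfun s) * cabs (zeta s))) =
  cabs ((s - 1) * (cfun s * zeta s) * D) by rewrite !cabsM; ring.
rewrite DE; apply: le_trans (ler_cabsB _ _) _.
apply: le_trans (lerD (ler_cabsD _ _) (lexx _)) _; rewrite cabsN !cabsM.
have h1 := kernel_sum_le.
set Wk := \sum_(1 <= k < N.+1 | smooth (primes q) k) k%:R `^ (- w) : R.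
have h2 : cabs (\sum_(1 <= k < N.+1 | smooth (primes q) k) G k) <=
    cabs (s - 1) * (2 `^ sigma0 * efun s) * X `^ (- sigma0) * Wk.
  apply: le_trans (ler_cabs_sum _ _ _) _; rewrite mulr_sumr.
  rewrite big_nat_cond [leRHS]big_nat_cond; apply: ler_sum => k /andP[/andP[k0 kN] _].
  exact: G_le.
have sE : complex.Re s = w + sigma0 by rewrite /w subrK.
have aP : all prime (primes q) by apply/allP => p; rewrite mem_primes => /andP[].
have h3 := smooth_tail_le N aP (primes_uniq q) hw (ltW sigma00) sE.
rewrite -/Ls -/Lw -/Wk in h3.
have LW : 0 <= Lw - Wk.
  by have := le_trans (cabs_ge0 _) h3; rewrite pmulr_rge0 // powR_gt0 ltr0n.
(* Here the weight at N + 1 in the tail bound pays off: N + 1 exceeds X, while N does not. *)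
have h4 : N.+1%:R `^ (- sigma0) <= X `^ (- sigma0).
  rewrite !powRN lef_pV2 ?posrE ?powR_gt0 ?ltr0n //.
  by rewrite ge0_ler_powR ?nnegrE ?(ltW sigma00) ?(ltW X0) ?(ltW XN).
have h5 := le_trans h3 (ler_wpM2r LW h4).
have c0 : 0 <= cabs (s - 1) * cabs (cfun s) by rewrite mulr_ge0 ?cabs_ge0.
apply: le_trans (lerD (lerD h1 h2) (ler_wpM2l c0 h5)) _.
have h6 : 0 <= cabs (s - 1) * (2 `^ sigma0 * efun s) * X `^ (- sigma0) * (Lw - Wk).
  by rewrite mulr_ge0 ?coef_ge0.
(* The losses |c(s)| (Lw - Wk) and 2^sigma0 e(s) Wk are each completed to a multiple of Lw; the
   difference is the sum of the two completions. *)
rewrite -subr_ge0 [leRHS](_ : _ =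
  cabs (s - 1) * (2 `^ sigma0 * efun s) * X `^ (- sigma0) * (Lw - Wk) +
  cabs (s - 1) * cabs (cfun s) * (X `^ (- sigma0) * Wk)); last by ring.
rewrite addr_ge0 // !mulr_ge0 ?cabs_ge0 ?powR_ge0 //.
by apply: sumr_ge0 => k _; exact: powR_ge0.
Qed.

End MainEstimate.

(** * The integral of |m_q| as a finite sum *)

Section MertensIntegral.
Context {R : realType}.
Variables (q : nat) (X : R).
Hypothesis X1 : 1 <= X.
Let mu := @lebesgue_measure R.

Lemma integral_mq : \int[mu]_(t in `[1, X]) `|mq q t| = abs_sum X q.
Proof.
set N := Num.truncn X.
have N1 : (1 <= N)%N by rewrite /N truncn_gt0.
have X0 : 0 <= X by apply: le_trans X1.
have NX : N%:R <= X by rewrite truncn_le.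
have XN : X < N.+1%:R by exact: truncnS_gt.
pose I (n : nat) : set R := `[n%:R, n.+1%:R[%classic.
have mI n : measurable (I n) by exact: measurable_itv.
have mD : measurable (`[1, X]%classic : set R) by exact: measurable_itv.
pose f (n : nat) (t : R) : \bar R := (`|mq q (n%:R : R)|%:E * (\1_(I n) t)%:E)%E.
have fE t : t \in (`[1, X]%classic : set R) ->
    `|mq q t|%:E = (\sum_(n <- index_iota 1 N.+1) f n t)%E.
  rewrite inE /= in_itv /= => /andP[t1 tX].
  have t0 : 0 <= t by apply: le_trans t1.
  set k := Num.truncn t.
  have k1 : (1 <= k)%N by rewrite /k truncn_gt0.
  have kN : (k <= N)%N by rewrite /k /N; apply: le_truncn.
  have kt : k%:R <= t < k.+1%:R by exact: truncn_itv.
  rewrite (bigD1_seq k) ?iota_uniq ?mem_index_iota ?k1 //=.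
  rewrite big1 ?adde0.
    rewrite /f indicE mem_set /I /= ?in_itv //= mule1.
    by rewrite /mq natrK.
  move=> n nk; have nI : ~ I n t.
    rewrite /I /= in_itv /= => nt.
    by move: nk; rewrite /k (truncn_def nt) eqxx.
  by rewrite /f indicE memNset // mule0.
rewrite /Rintegral.
transitivity (fine (\int[mu]_(t in `[1%R, X]) (\sum_(n <- index_iota 1 N.+1) f n t))%E).
  by congr fine; apply: eq_integral => t /fE.
rewrite ge0_integral_sum //; first last.
- by move=> n t _; rewrite /f mule_ge0 // lee_fin.
- move=> n; rewrite /f; apply: measurable_funeM.
  by apply/measurable_EFinP; apply: measurable_indic; exact: mI.
have int_f n : (\int[mu]_(t in `[1%R, X]) f n t = `|mq q (n%:R : R)|%:E * mu (I n `&` `[1%R, X]))%E.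
  rewrite /f ge0_integralZl_EFin //.
    by rewrite integral_indic //; exact: mI.
  by apply/measurable_EFinP; apply: measurable_indic; exact: mI.
rewrite (eq_bigr _ (fun n _ => int_f n)) big_nat_recr //= /abs_sum -/N.
have -> : I N `&` `[1, X]%classic = `[N%:R, X]%classic.
  apply/seteqP; split => t; rewrite /I /= !in_itv /=.
    by case=> /andP[-> _] /andP[_ ->].
  move=> /andP[Nt tX]; rewrite Nt tX (le_lt_trans tX XN) (le_trans _ Nt) //.
  by rewrite ler1n.
have -> : mu `[N%:R, X]%classic = (X - N%:R)%:E.
  rewrite /mu lebesgue_measure_itv /= lte_fin; case: ltP => // XN'.
  by rewrite (_ : X = N%:R) ?subrr //; apply/eqP; rewrite eq_le XN' NX.
have -> : (\sum_(1 <= n < N) `|mq q (n%:R : R)|%:E * mu (I n `&` `[1%R, X]))%E =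
   (\sum_(1 <= n < N) `|mq q n%:R|)%:E.
  rewrite -sumEFin big_nat_cond [RHS]big_nat_cond; apply: eq_bigr => n /andP[/andP[n1 nN] _].
  have -> : I n `&` `[1, X]%classic = I n.
    apply/setIidPl => t; rewrite /I /= !in_itv /= => /andP[nt tn].
    rewrite (le_trans _ nt) ?ler1n //= (le_trans (ltW tn)) // (le_trans _ NX) //.
    by rewrite ler_nat.
  rewrite /I /mu lebesgue_measure_itv /= lte_fin ltr_nat ltnSn.
  by rewrite -EFinB -[n.+1]addn1 natrD addrAC subrr add0r mule1.
by rewrite -EFinM -EFinD.
Qed.

End MertensIntegral.

(** * Zeros of c(s) *)

Section ZeroesOfC.
Context {R : realType}.
Implicit Types (x : R) (s : R[i]).

Lemma sin_int_pi (k : int) : sin (k%:~R * pi) = 0 :> R.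
Proof.
have nat_pi n : sin (n%:R * pi) = 0 :> R.
  elim: n => [|n ih]; first by rewrite mul0r sin0.
  by rewrite -addn1 natrD mulrDl mul1r sinDpi ih oppr0.
case: k => n; first exact: nat_pi.
by rewrite NegzE rmorphN mulNr sinN [sin _]nat_pi oppr0.
Qed.

Lemma sin_eq0_int x : sin x = 0 -> exists k : int, x = k%:~R * pi.
Proof.
move=> sx; have pi0 : 0 < pi :> R := pi_gt0 R.
exists (Num.floor (x / pi)); set k := Num.floor _.
have kE : k%:~R <= x / pi < k%:~R + 1.
  by rewrite floor_le_tmp /= -[1]/(1%:~R) -intrD floorD1_gt.
apply/eqP; rewrite -subr_eq0; apply/eqP.
set y := x - _.
have y0 : 0 <= y by rewrite subr_ge0 -ler_pdivlMr //; case/andP: kE.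
have yp : y < pi by rewrite ltrBlDl -[X in _ + X]mul1r -mulrDl -ltr_pdivrMr //; case/andP: kE.
have sy : sin y = 0.
  by rewrite /y sinB sx sin_int_pi mul0r mulr0 subrr.
move: y0; rewrite le_eqVlt => /predU1P[//|y0].
by have := sin_gt0_pi (x := y); rewrite sy ltxx y0 yp => /(_ isT).
Qed.

Lemma cos_eq1_int x : cos x = 1 -> exists k : int, x = 2 * pi * k%:~R.
Proof.
move=> cx.
have : cos (x / 2 + x / 2) = 1 by rewrite -splitr.
rewrite cosD -!expr2 cos2sin2 => h.
have : sin (x / 2) = 0 by apply/eqP; rewrite -sqrf_eq0; apply/eqP; lra.
case/sin_eq0_int => k hk; exists k.
by rewrite -mulrA [pi * _]mulrC -hk mulrC divfK.
Qed.

(** If 2^(1-s) = 1, the modulus forces Re s = 1 and the real part forces cos(Im s ln 2) = 1; the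
    integer obtained is nonzero because s is not 1. *)
Lemma cfun_neq0 s : s != 1 -> ~ Zset s -> cfun s != 0.
Proof.
move=> s1 hZ; rewrite /cfun (negbTE s1) mulf_neq0 //; last by rewrite invr_eq0 subr_eq0.
rewrite subr_eq0; apply/eqP => h1.
have l2 : 0 < ln 2 :> R by rewrite ln_gt0 // ltr1n.
case: s s1 hZ h1 => u v s1 hZ h1.
have hu : u = 1.
  have := congr1 (@cabs R) h1; rewrite cabs1 cabs_cpow // /powR gt_eqF //= => h2.
  have /expR_inj/esym/eqP : expR 0 = expR ((1 - u) * ln 2) by rewrite expR0.
  rewrite mulf_eq0 (gt_eqF l2) orbF subr_eq0.
  by move/eqP.
have hc : cos (v * ln 2) = 1.
  have E : (1 - (1 +i* v)) * (ln 2)%:C = 0 +i* (- (v * ln 2)).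
    by apply/eqP; rewrite eq_complex /=; apply/andP; split; apply/eqP; ring.
  have := congr1 (@complex.Re R) h1; rewrite /cpow hu E /cexp /=.
  by rewrite expR0 cosN mul0r mul1r subr0.
have [k hk] := cos_eq1_int hc.
apply: hZ; exists k.
  apply: contra s1 => /eqP k0; rewrite eq_complex /= hu eqxx /=.
  by move: hk; rewrite k0 mulr0 => /eqP; rewrite mulf_eq0 (gt_eqF l2) orbF.
by rewrite hu -hk mulfK // gt_eqF.
Qed.

End ZeroesOfC.

(** * The estimate in the extended reals *)

Section ErrorBound.
Context {R : realType}.
Variable zeta : R[i] -> R[i].
Hypothesis hzeta : is_riemann_zeta zeta.
Variables (X : R) (q : nat) (sigma0 : R) (s : R[i]).
Hypotheses (X1 : 1 <= X) (q0 : (0 < q)%N) (sigma00 : 0 < sigma0).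
Hypotheses (s1 : s != 1) (z0 : zeta s != 0) (sZ : ~ Zset s).
Hypothesis sigma0s : sigma0 <= complex.Re s.

(** Stated for every K at least |s|/sigma, so that (sigma + |s|)/sigma and, for real s, 1 are both
    instances. *)
Lemma error_bound_le (K : R) : cabs s / complex.Re s <= K ->
  ((cabs (\sum_(1 <= n < (Num.truncn X).+1 | coprime n q)
        (mobius n)%:~R / cpow n%:R s
     - (mq q X)%:C / cpow X (s - 1)
     - cpow q%:R s / varphi s q * inv_zeta zeta s))%:E
   <= error_bound zeta X sigma0 q s K)%E.
Proof.
move=> hK; have s0 : 0 < complex.Re s := lt_le_trans sigma00 sigma0s.
have X0 : 0 < X := lt_le_trans ltr01 X1.
have c0 : 0 < cabs (cfun s) by rewrite cabs_gt0 cfun_neq0.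
have zz0 : 0 < cabs (zeta s) by rewrite cabs_gt0.
have q0r : 0 < q%:R :> R by rewrite ltr0n.
rewrite /error_bound integral_mq // /inv_zeta (negbTE s1).
have -> : cpow q%:R s / varphi s q = (euler_prod (primes q) s)^-1.
  by rewrite /varphi -/(euler_prod _ _) invfM mulrA mulfV ?mul1r // cpow_neq0.
set lhs := cabs _; set w := complex.Re s - sigma0.
have w0 : 0 <= w by rewrite subr_ge0.
have aP : all prime (primes q) by apply/allP => p; rewrite mem_primes => /andP[].
have -> : complex.Re (varphi w%:C q) =
    q%:R `^ w * \prod_(p <- primes q) (1 - p%:R `^ (- w)).
  rewrite /varphi -/(euler_prod _ _) cpow_real // (euler_prodE_real _ aP).
  by rewrite -rmorphM.
set Pw := \prod_(_ <- _) _.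
have qw : 0 < q%:R `^ w by rewrite powR_gt0.
set iz := cabs _^-1 / _.
have izE : iz = (cabs (cfun s) * cabs (zeta s))^-1 by rewrite /iz cabsV invfM mulrC.
have iz0 : 0 < iz by rewrite izE invr_gt0 mulr_gt0.
(* Strictness matters when the Euler product is 0: this coefficient then multiplies +oo, and 0 times
   +oo would be 0. *)
have coef0 : 0 < (cabs (cfun s) + 2 `^ sigma0 * efun s) * iz / X `^ sigma0.
  rewrite divr_gt0 ?powR_gt0 // mulr_gt0 // ltr_wpDr //.
  by rewrite mulr_ge0 ?powR_ge0 // efun_ge0.
have [Pw0|Pw0] := eqVneq Pw 0.
  by rewrite Pw0 mulr0 inve0 gt0_muley ?lte_fin // gt0_muley ?lte_fin // addey ?leey.
(* At w = 0 each Euler factor is 1 - 1 = 0, so a nonzero product leaves only q without prime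
   factors. *)
have hw : 0 < w \/ primes q = [::].
  case: (primes q) @Pw Pw0 {aP} => [|p P] /=; first by right.
  rewrite big_cons mulf_eq0 negb_or => /andP[h _]; left.
  rewrite lt_neqAle w0 andbT; apply: contra h => /eqP <-.
  by rewrite oppr0 powRr0 subrr.
have := main_estimate hzeta s0 s1 X1 q0 sigma00 hw z0.
rewrite -/lhs -/w -/Pw.
rewrite inver mulf_eq0 (negbTE Pw0) (gt_eqF qw) /= -!EFinM -EFinD lee_fin.
rewrite -ler_pdivlMr ?mulr_gt0 // -izE => /le_trans; apply.
rewrite invfM [q%:R `^ w * _]mulrA mulfV ?gt_eqF // mul1r mulrDl; apply: lerD.
  have -> : cabs s / complex.Re s * X `^ (- complex.Re s) * abs_sum X q * iz =
    cabs s / complex.Re s * (iz * X `^ (- complex.Re s) * abs_sum X q) by ring.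
  have -> : K * iz / X `^ complex.Re s * abs_sum X q =
    K * (iz * X `^ (- complex.Re s) * abs_sum X q) by rewrite powRN; ring.
  apply: ler_wpM2r hK; apply: mulr_ge0.
    by apply: mulr_ge0; [exact: ltW|exact: powR_ge0].
  rewrite /abs_sum addr_ge0 ?sumr_ge0 // mulr_ge0 // subr_ge0 truncn_le.
  exact: ltW.
rewrite powRN le_eqVlt; apply/orP; left; apply/eqP; ring.
Qed.

End ErrorBound.

Unset Implicit Arguments.
Set Strict Implicit.

Theorem theorem1p5 (R : realType) (zeta : R[i] -> R[i])
    (hzeta : is_riemann_zeta zeta)
    (X : R) (hX : 1 <= X) (q : nat) (hq : (0 < q)%N)
    (sigma0 : R) (hsigma0 : 0 < sigma0)
    (s : R[i]) (hs : s != 1 -> zeta s != 0) (hsZ : ~ Zset s)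
    (hsigma : sigma0 <= complex.Re s) :
  let lhs : R := cabs
    (\sum_(1 <= n < (Num.truncn X).+1 | coprime n q)
        (mobius n)%:~R / cpow n%:R s
     - (mq q X)%:C / cpow X (s - 1)
     - cpow q%:R s / varphi s q * inv_zeta zeta s) in
  (lhs%:E <=
     error_bound zeta X sigma0 q s ((complex.Re s + cabs s) / complex.Re s))%E /\
  (complex.Im s = 0 -> (lhs%:E <= error_bound zeta X sigma0 q s 1)%E).
Proof.
have s0 : 0 < complex.Re s := lt_le_trans hsigma0 hsigma.
have [s1|s1] := eqVneq s 1; last first.
  split=> [|s_real]; apply: error_bound_le; rewrite ?hs //.
    by rewrite mulrDl mulfV ?gt_eqF // lerDr.
  by rewrite cabs_Re ?(ltW s0) // mulfV // gt_eqF.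
(* At s = 1 the value 0 of [inv_zeta] kills both terms, the second even against +oo, since 0 times
   +oo is 0. *)
have err0 K : error_bound zeta X sigma0 q s K = 0%E.
  by rewrite /error_bound /inv_zeta s1 eqxx cabs0 !(mul0r, mulr0) mul0e adde0.
rewrite !err0 /= (_ : cabs _ = 0) // (_ : _ - _ - _ = 0) ?cabs0 //.
(* As X^(s-1) = 1, the left-hand side is m_q(X) minus itself. *)
rewrite /inv_zeta s1 eqxx mulr0 subr0 subrr cpow0 divr1 /mq rmorph_sum.
apply/eqP; rewrite subr_eq0; apply/eqP.
rewrite big_nat_cond [RHS]big_nat_cond; apply: eq_bigr => n /andP[/andP[n1 _] _].
by rewrite cpow1 ?ltr0n // rmorphM /= fmorphV rmorph_int.
Qed.
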